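(* Let $\mathbb{SU}=\prod_{n=1}^\infty SU(n)$. For a comeager set of $G\in\mathcal{S}(\mathbb{SU})$, the identity component $G^\circ$ is not a Lie group.
   Context: $\mathbb{SU}$ carries the product topology, metrized by $d(x,y)=\sum_n 2^{-n}d_n(x(n),y(n))$ where $d_n\le 1$ is a biinvariant metric on $SU(n)$. $\mathcal{S}(\mathbb{SU})$ is the set of nonempty compact subgroups of $\mathbb{SU}$ with the Hausdorff metric induced by $d$. $G^\circ$ is the connected component of the identity of $G$. *)

(* Defs.v *)
From HB Require Import structures.
From mathcomp Require Import all_boot all_order all_algebra.
From mathcomp Require Import spectral complex.
From mathcomp Require Import all_classical all_reals all_analysis.
From mathcomp Require Import lra.

Set Implicit Arguments.
Unset Strict Implicit.
Unset Printing Implicit Defensive.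

Import Order.TTheory GRing.Theory Num.Theory.
Import numFieldNormedType.Exports.

Local Open Scope classical_set_scope.
Local Open Scope ring_scope.

HB.mixin Record isTopGroup G of Group G & Topological G := {
  mulg_continuous : continuous (fun xy : G * G => (xy.1 * xy.2)%g);
  invg_continuous : continuous (fun x : G => x^-1%g)
}.

#[short(type="topGroupType")]
HB.structure Definition TopGroup :=
  {G of Group G & Topological G & isTopGroup G}.

Lemma mulg_cvg (G : topGroupType) (T : Type) (F : set_system T) (FF : Filter F)
    (f g : T -> G) (a b : G) :
  f @ F --> a -> g @ F --> b -> (fun t => f t * g t)%g @ F --> (a * b)%g.
Proof.
move=> fa gb.
apply: (@cvg_comp _ _ _ (fun t => (f t, g t)) (fun xy : G * G => (xy.1 * xy.2)%g)
  F (nbhs (a, b)) _ _ (@mulg_continuous G (a, b))).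
exact: cvg_pair.
Qed.

Lemma invg_cvg (G : topGroupType) (T : Type) (F : set_system T) (FF : Filter F)
    (f : T -> G) (a : G) :
  f @ F --> a -> (fun t => (f t)^-1)%g @ F --> (a^-1)%g.
Proof.
move=> fa; exact: (@cvg_comp _ _ _ f (fun x : G => x^-1%g) F (nbhs a) _ fa
  (@invg_continuous G a)).
Qed.

Section ProductTopology.
Context {I : Type} (T : I -> topologicalType).
Local Notation P := (prod_topology T).

Lemma prod_cvgP (U : Type) (F : set_system U) (FF : Filter F) (f : U -> P) (x : P) :
  (forall i, (fun u => f u i) @ F --> x i) -> f @ F --> x.
Proof.
move=> fx; apply/cvg_sup => i A [_ [[C oC <-] Cx CA]].
rewrite nbhs_filterE; apply: filterS CA _.
by apply: (fx i); apply: open_nbhs_nbhs.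
Qed.

Lemma prod_coord_continuous i : continuous (fun x : P => x i).
Proof.
move=> x A; rewrite {1}nbhsE => -[B [oB Bx] BA].
have [+ _] := @cvg_sup P I
  (fun j => Topological.class (initial_topology (fun f : P => f j)))
  (nbhs x) x (nbhs_filter x).
move=> /(_ (fun _ => id) i); apply; exists ((fun y : P => y i) @^-1` B); split => //; first by exists B.
by move=> y; exact: BA.
Qed.
End ProductTopology.

Section ProductGroup.
Context {I : Type} (T : I -> topGroupType).
Local Notation P := (prod_topology T).

Let one : P := fun i => 1%g.
Let inv (x : P) : P := fun i => (x i)^-1%g.
Let mul (x y : P) : P := fun i => (x i * y i)%g.

Let mulA : associative mul.
Proof. by move=> x y z; apply: functional_extensionality_dep => i; exact: mulgA. Qed.
Let mul1 : left_id one mul.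
Proof. by move=> x; apply: functional_extensionality_dep => i; exact: mul1g. Qed.
Let mulr1 : right_id one mul.
Proof. by move=> x; apply: functional_extensionality_dep => i; exact: mulg1. Qed.
Let mulV : left_inverse one inv mul.
Proof. by move=> x; apply: functional_extensionality_dep => i; exact: mulVg. Qed.
Let mulrV : right_inverse one inv mul.
Proof. by move=> x; apply: functional_extensionality_dep => i; exact: mulgV. Qed.

HB.instance Definition _ := isGroup.Build P mulA mul1 mulr1 mulV mulrV.

Let mul_cont : continuous (fun xy : P * P => (xy.1 * xy.2)%g).
Proof.
move=> [x y]; apply: prod_cvgP => i.
apply: mulg_cvg.
  apply: (@cvg_comp _ _ _ fst (fun x : P => x i)); first exact: cvg_fst.
  exact: prod_coord_continuous.
apply: (@cvg_comp _ _ _ snd (fun x : P => x i)); first exact: cvg_snd.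
exact: prod_coord_continuous.
Qed.

Let inv_cont : continuous (fun x : P => x^-1%g).
Proof.
move=> x; apply: (prod_cvgP (nbhs_filter x)) => i.
exact: (@invg_cvg _ _ (nbhs x) (nbhs_filter x) _ _ (@prod_coord_continuous I T i x)).
Qed.

HB.instance Definition _ := isTopGroup.Build P mul_cont inv_cont.
End ProductGroup.

Section SubTopGroup.
Context (G : topGroupType).

Definition is_subgroup (H : set G) : Prop := group_closed [in H].

(* sgH is an argument so that the group structure can be inferred *)
Definition subgroup_type (H : set G) (sgH : is_subgroup H) : Type := set_type H.

Context (H : set G) (sgH : is_subgroup H).
Local Notation S := (subgroup_type sgH).

HB.instance Definition _ := SubChoice.copy S (set_type H).
HB.instance Definition _ := Topological.copy S (set_type H).
HB.instance Definition _ := SubChoice_isSubGroup.Build G [in H] S sgH.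

Let cvg_sub (T : Type) (F : set_system T) (FF : Filter F) (f : T -> S) (x : S) :
  (fun t => val (f t)) @ F --> val x -> f @ F --> x.
Proof.
move=> fx A [_ [[C oC <-] Cx CA]].
rewrite nbhs_filterE; apply: filterS CA _.
by apply: fx; apply: open_nbhs_nbhs.
Qed.

Let val_cont : continuous (val : S -> G).
Proof. exact: initial_continuous. Qed.

Let mul_cont : continuous (fun xy : S * S => (xy.1 * xy.2)%g).
Proof.
move=> [x y]; apply: cvg_sub => /=.
apply: (@mulg_cvg G _ (nbhs (x, y)) _ (fun p => val p.1) (fun p => val p.2)).
  apply: (@cvg_comp _ _ _ fst (val : S -> G)); first exact: cvg_fst.
  exact: val_cont.
apply: (@cvg_comp _ _ _ snd (val : S -> G)); first exact: cvg_snd.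
exact: val_cont.
Qed.

Let inv_cont : continuous (fun x : S => x^-1%g).
Proof.
move=> x; apply: (cvg_sub (nbhs_filter x)) => /=.
exact: (@invg_cvg G _ (nbhs x) (nbhs_filter x) (fun y : S => val y) _ (@val_cont x)).
Qed.

HB.instance Definition _ := isTopGroup.Build S mul_cont inv_cont.
End SubTopGroup.

Section IdentityComponent.
Context (G : topGroupType).

Definition identity_component (H : set G) : set G := connected_component H 1%g.

Lemma identity_component_subgroup (H : set G) :
  is_subgroup H -> is_subgroup (identity_component H).
Proof.
move=> [H1 HV]; split.
  by rewrite inE; apply: connected_component_refl; rewrite inE in H1.
move=> x y /set_mem Cx /set_mem Cy; apply/mem_set.
have H0 : H 1%g by rewrite inE in H1.
pose f (z : G) : G := (z / y)%g.
have cf : continuous f.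
  move=> z; apply: (@mulg_cvg G _ (nbhs z) (nbhs_filter z) id (fun _ => y^-1%g)).
    exact: cvg_id.
  exact: cvg_cst.
pose C := connected_component H (1%g : G).
have sC : C `<=` H by exact: connected_component_sub.
apply: (@connected_component_max _ H (f @` C)).
- by exists y => //; rewrite /f mulgV.
- move=> _ [z Cz <-]; apply/set_mem/HV; apply/mem_set; exact: sC.
- apply: connected_continuous_connected; first exact: component_connected.
  exact: continuous_subspaceT.
- by exists x.
Qed.
End IdentityComponent.

(* the topology of the modulus, which is not inferred on R[i] itself *)
HB.instance Definition _ (R : realType) := PseudoMetric.copy R[i] R[i]^o.

Section SpecialUnitary.
Local Open Scope sesquilinear_scope.
Variables (R : realType) (n : nat).

Definition special_unitary : set 'M[R[i]]_n :=
  [set A | A \is unitarymx /\ \det A = 1].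

Definition SU : Type := set_type special_unitary.

HB.instance Definition _ := SubChoice.copy SU (set_type special_unitary).
HB.instance Definition _ := Topological.copy SU (set_type special_unitary).

Let mxSU (A : 'M[R[i]]_n) (hA : special_unitary A) : SU := Sub A (mem_set hA).

Let SU1 : special_unitary 1%:M.
Proof.
split; last exact: det1.
by apply/unitarymxP; rewrite trmx1 map_mx1 mulmx1.
Qed.

Let SUM (A B : SU) : special_unitary (val A *m val B).
Proof.
have [[uA dA] [uB dB]] := (set_mem (valP A), set_mem (valP B)).
by split; [exact: mul_unitarymx|rewrite det_mulmx dA dB mulr1].
Qed.

Let SUV (A : SU) : special_unitary ((val A)^t*).
Proof.
have [uA dA] := set_mem (valP A).
split; first by rewrite trmxC_unitary.
by rewrite det_map_mx det_tr dA rmorph1.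
Qed.

Let SU_one : SU := mxSU SU1.
Let SU_mul (A B : SU) : SU := mxSU (SUM A B).
Let SU_inv (A : SU) : SU := mxSU (SUV A).

Let mulA : associative SU_mul.
Proof. by move=> A B C; apply/val_inj; rewrite /= mulmxA. Qed.
Let mul1 : left_id SU_one SU_mul.
Proof. by move=> A; apply/val_inj; rewrite /= mul1mx. Qed.
Let mulr1 : right_id SU_one SU_mul.
Proof. by move=> A; apply/val_inj; rewrite /= mulmx1. Qed.
Let mulrV : right_inverse SU_one SU_inv SU_mul.
Proof.
move=> A; apply/val_inj; have [uA _] := set_mem (valP A).
exact/unitarymxP.
Qed.
Let mulV : left_inverse SU_one SU_inv SU_mul.
Proof.
by move=> A; apply/val_inj; rewrite /=; apply/mulmx1C; exact: (congr1 val (mulrV A)).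
Qed.

HB.instance Definition _ := isGroup.Build SU mulA mul1 mulr1 mulV mulrV.

Let mx_cvg (T : Type) (F : set_system T) (FF : Filter F) (f : T -> 'M[R[i]]_n)
    (A : 'M[R[i]]_n) :
  (forall i j, (fun t => f t i j) @ F --> A i j) -> f @ F --> A.
Proof.
move=> fA B [P PA PB]; rewrite nbhs_filterE; apply: filterS PB _.
apply: filter_forall => i; apply: filter_forall => j.
exact: (fA i j _ (PA i j)).
Qed.

Let coord_cont (i j : 'I_n) : continuous (fun A : SU => (val A) i j : R[i]).
Proof.
move=> A.
apply: (@cvg_comp _ _ _ (val : SU -> 'M[R[i]]_n) (fun M => M i j)).
  exact: initial_continuous.
exact: (@coord_continuous R[i] n n i j).
Qed.

Let cvg_SU (T : Type) (F : set_system T) (FF : Filter F) (f : T -> SU) (x : SU) :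
  (fun t => val (f t)) @ F --> val x -> f @ F --> x.
Proof.
move=> fx A [_ [[C oC <-] Cx CA]].
rewrite nbhs_filterE; apply: filterS CA _.
by apply: fx; apply: open_nbhs_nbhs.
Qed.

Let mul_cont : continuous (fun xy : SU * SU => (xy.1 * xy.2)%g).
Proof.
move=> [x y]; apply: (cvg_SU (nbhs_filter (x, y))); apply: mx_cvg => i j.
rewrite mxE; under eq_fun do rewrite mxE.
apply: (@cvg_big R[i] 'I_n +%R 0 xpredT (@add_continuous R[i]^o)) => // k _.
apply: (@cvgM R[i] _ (nbhs (x, y)) (nbhs_filter _)
  (fun p : SU * SU => (val p.1) i k) (fun p => (val p.2) k j)).
  apply: (@cvg_comp _ _ _ fst (fun A : SU => (val A) i k)); first exact: cvg_fst.
  exact: coord_cont.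
apply: (@cvg_comp _ _ _ snd (fun A : SU => (val A) k j)); first exact: cvg_snd.
exact: coord_cont.
Qed.

Let conj_cont : continuous (fun z : R[i] => z^* : R[i]).
Proof.
move=> z; apply/(@cvgrPdist_lt R[i] R[i]^o _ (nbhs (z : R[i]^o)) (nbhs_filter _)).
move=> e e0; near=> w.
rewrite -rmorphB norm_conjC.
by near: w; apply: (@cvgr_dist_lt R[i] R[i]^o).
Unshelve. all: by end_near. Qed.

Let inv_cont : continuous (fun x : SU => x^-1%g).
Proof.
move=> x; apply: (cvg_SU (nbhs_filter x)); apply: mx_cvg => i j.
rewrite 2!mxE; under eq_fun do rewrite 2!mxE.
apply: (@cvg_comp _ _ _ (fun A : SU => (val A) j i) (fun z : R[i] => z^*)).
  exact: coord_cont.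
exact: conj_cont.
Qed.

HB.instance Definition _ := isTopGroup.Build SU mul_cont inv_cont.
End SpecialUnitary.

Record bounded_metric (R : realType) (T : topologicalType) := BoundedMetric {
  bdist :> T -> T -> R;
  bdistxx : forall x, bdist x x = 0;
  bdist_eq0 : forall x y, bdist x y = 0 -> x = y;
  bdistC : forall x y, bdist x y = bdist y x;
  bdist_triangle : forall y x z, bdist x z <= bdist x y + bdist y z;
  bdist_le1 : forall x y, bdist x y <= 1;
  bdist_nbhs : forall x (A : set T),
    nbhs x A <-> exists2 e, 0 < e & [set y | bdist x y < e] `<=` A
}.

Record biinvariant_metric (R : realType) (G : topGroupType) := BiinvariantMetric {
  bimetric :> bounded_metric R G;
  bimetricMl : forall g x y : G, bimetric (g * x)%g (g * y)%g = bimetric x y;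
  bimetricMr : forall g x y : G, bimetric (x * g)%g (y * g)%g = bimetric x y
}.

Lemma bdist_ge0 (R : realType) (T : topologicalType) (d : bounded_metric R T) x y :
  0 <= d x y.
Proof.
rewrite -(@pmulrn_lge0 _ _ 2)// -(bdistxx d x).
by rewrite (le_trans (bdist_triangle d y _ _))// [d y x]bdistC -mulr2n.
Qed.

Lemma bdist_hausdorff (R : realType) (T : topologicalType)
  (d : bounded_metric R T) : hausdorff_space T.
Proof.
move=> x y xy; apply: (bdist_eq0 (b := d)); apply/eqP; rewrite eq_le bdist_ge0 andbT.
rewrite leNgt; apply/negP => dxy.
have e0 : 0 < d x y / 2 by rewrite divr_gt0.
have nx : nbhs x [set z | d x z < d x y / 2] by apply/(bdist_nbhs d); exists (d x y / 2).
have ny : nbhs y [set z | d y z < d x y / 2] by apply/(bdist_nbhs d); exists (d x y / 2).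
have [z [/= xz yz]] := xy _ _ nx ny.
have := bdist_triangle d z x y; rewrite leNgt => /negP; apply.
by rewrite [ltRHS]splitr ltrD// bdistC.
Qed.

Section ProductMetric.
Context (R : realType) (T : nat -> topologicalType).
Variable d : forall k, bounded_metric R (T k).
Local Notation P := (prod_topology T).
Implicit Types x y z : P.

(* T k is the factor of index n = k + 1, hence the weight 2^-(k + 1) *)
Let term x y : R ^nat := fun k => 2 ^- k.+1 * d k (x k) (y k).

Definition prod_dist x y : R := limn (series (term x y)).

Let w_ge0 k : 0 <= 2 ^- k.+1 :> R.
Proof. by rewrite invr_ge0 exprn_ge0. Qed.

Let w_ge0' k : 0 <= 2 ^- k :> R.
Proof. by rewrite invr_ge0 exprn_ge0. Qed.

Let w_gt0 k : 0 < 2 ^- k.+1 :> R.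
Proof. by rewrite invr_gt0 exprn_gt0. Qed.

Let term_ge0 x y k : 0 <= term x y k.
Proof. by rewrite mulr_ge0// bdist_ge0. Qed.

Let sumw m n : (m <= n)%N ->
  \sum_(m <= k < n) (2 ^- k.+1 : R) = 2 ^- m - 2 ^- n.
Proof.
move=> mn; rewrite (eq_bigr (fun k => (- 2 ^- k.+1) - (- 2 ^- k : R))).
  by rewrite telescope_sumr// opprK addrC.
move=> k _; rewrite opprK addrC exprS invfM.
have /eqP : (1 : R) - 2^-1 - 2^-1 = 0 by lra.
by rewrite -addrA -opprD; lra.
Qed.

Let sum_le x y m n : (m <= n)%N ->
  \sum_(m <= k < n) term x y k <= 2 ^- m.
Proof.
move=> mn; apply: (@le_trans _ _ (\sum_(m <= k < n) 2 ^- k.+1)).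
  by apply: ler_sum => k _; rewrite ler_piMr// bdist_le1.
by rewrite sumw// lerBlDr lerDl invr_ge0 exprn_ge0.
Qed.

Let series_nd x y : nondecreasing_seq (series (term x y)).
Proof. by apply/nondecreasing_series => k _ _; exact: term_ge0. Qed.

Lemma is_cvg_prod_dist x y : cvgn (series (term x y)).
Proof.
apply: nondecreasing_is_cvgn; first exact: series_nd.
by exists 1 => _ [n _ <-]; rewrite /series/= (le_trans (sum_le _ _ _))// expr0 invr1.
Qed.

Let series_le x y n : series (term x y) n <= prod_dist x y.
Proof. exact: (nondecreasing_cvgn_le (@series_nd x y) (@is_cvg_prod_dist x y)). Qed.

Let dist_le x y n : prod_dist x y <= series (term x y) n + 2 ^- n.
Proof.
apply: limr_le; first exact: is_cvg_prod_dist.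
exists n => // m /= nm.
by rewrite /series/= (big_cat_nat (n := n))//= lerD2l sum_le.
Qed.

Let term_le x y k : term x y k <= prod_dist x y.
Proof.
apply: le_trans (series_le _ _ k.+1); rewrite /series/= big_nat_recr//= lerDr.
by apply: sumr_ge0 => ? _; exact: term_ge0.
Qed.

Let prod_distxx x : prod_dist x x = 0.
Proof.
rewrite /prod_dist (_ : series _ = fun=> 0) ?lim_cst//.
by apply/funext => n; rewrite /series/= big1// => k _; rewrite /term bdistxx mulr0.
Qed.

Let prod_dist_eq0 x y : prod_dist x y = 0 -> x = y.
Proof.
move=> xy; apply: functional_extensionality_dep => k; apply: (bdist_eq0 (b := d k)).
have := @term_le x y k; rewrite xy pmulr_rle0// => h.
by apply/eqP; rewrite eq_le h bdist_ge0.
Qed.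

Let prod_distC x y : prod_dist x y = prod_dist y x.
Proof.
by rewrite /prod_dist; congr (limn (series _)); apply/funext => k; rewrite /term bdistC.
Qed.

Let prod_dist_triangle y x z : prod_dist x z <= prod_dist x y + prod_dist y z.
Proof.
rewrite /prod_dist -lim_seriesD; [|exact: is_cvg_prod_dist..].
apply: lim_series_le; [exact: is_cvg_prod_dist| |].
  by apply: is_cvg_seriesD; exact: is_cvg_prod_dist.
by move=> k; rewrite -mulrDr ler_wpM2l// bdist_triangle.
Qed.

Let prod_dist_le1 x y : prod_dist x y <= 1.
Proof. by have := @dist_le x y 0; rewrite /series/= big_geq// add0r expr0 invr1. Qed.

Let prod_dist_nbhs x (A : set P) :
  nbhs x A <-> exists2 e, 0 < e & [set y | prod_dist x y < e] `<=` A.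
Proof.
split=> [xA|[e e0 eA]].
  pose F := filter_from [set e : R | 0 < e] (fun e => [set y | prod_dist x y < e]).
  have FF : Filter F.
    apply: filter_from_filter; first by exists 1; rewrite /= ltr01.
    move=> a b a0 b0; exists (Num.min a b); first by rewrite /= lt_min a0.
    by move=> y /=; rewrite lt_min => /andP[].
  have Fx : id @ F --> x.
    apply: (prod_cvgP FF) => i B /(bdist_nbhs (d i))[e e0 eB].
    exists (2 ^- i.+1 * e); first by rewrite /= mulr_gt0.
    move=> y /= xy; apply: eB => /=.
    by rewrite -(ltr_pM2l (w_gt0 i)) (le_lt_trans (term_le _ _ i)).
  by have [e e0 eA] := Fx A xA; exists e.
have e20 : 0 < e / 2 by rewrite divr_gt0.
have [n _ ne] := near_infty_natSinv_expn_lt (PosNum e20).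
have {}ne : 2 ^- n < e / 2 :> R by have := ne n (leqnn n); rewrite /= div1r.
apply: (@filterS _ (nbhs x) _ [set y | forall k : 'I_n, d k (x k) (y k) < e / 2]).
  move=> y /= yn; apply: eA => /=; apply: le_lt_trans (dist_le _ _ n) _.
  rewrite [ltRHS]splitr ler_ltD// /series/= big_mkord.
  apply: (@le_trans _ _ (\sum_(k < n) 2 ^- k.+1 * (e / 2))).
    by apply: ler_sum => k _; rewrite ler_pM2l// ltW.
  rewrite -mulr_suml -(big_mkord xpredT (fun k => 2 ^- k.+1)) sumw//.
  by rewrite expr0 invr1 ler_piMl ?ltW// lerBlDr lerDl w_ge0'.
apply: (@filter_forall _ _ (fun (k : 'I_n) (y : P) => d k (x k) (y k) < e / 2) (nbhs x)).
move=> k; apply: (@prod_coord_continuous nat T k x [set z | d k (x k) z < e / 2]).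
by apply/(bdist_nbhs (d k)); exists (e / 2).
Qed.

Definition prod_metric : bounded_metric R P :=
  BoundedMetric prod_distxx prod_dist_eq0 prod_distC prod_dist_triangle
    prod_dist_le1 prod_dist_nbhs.
End ProductMetric.

Record compact_subgroup (G : topGroupType) := CompactSubgroup {
  csubgroup_set :> set G;
  csubgroupP : is_subgroup csubgroup_set;
  csubgroup_compact : compact csubgroup_set
}.

Section HausdorffMetric.
Context (R : realType) (G : topGroupType) (d : bounded_metric R G).
Implicit Types A B C : compact_subgroup G.

Definition excess (X Y : set G) : R := sup [set inf [set d x y | y in Y] | x in X].

Definition hausdorff_dist (X Y : set G) : R := Num.max (excess X Y) (excess Y X).

(* a copy of compact_subgroup G carrying the Hausdorff metric of d; nonemptiness
   of its members is automatic, as they contain 1 *)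
Definition subgroup_space (_ : bounded_metric R G) : Type := compact_subgroup G.

Lemma csubgroup1 A : (A : set G) 1%g.
Proof. by have [+ _] := csubgroupP A; rewrite inE. Qed.

Lemma csubgroup_inj A B : csubgroup_set A = csubgroup_set B -> A = B.
Proof.
case: A B => [A sA cA] [B sB cB] /= AB; case: _ / AB in sB cB *.
by congr CompactSubgroup; exact: Prop_irrelevance.
Qed.

Let has_lb (x : G) (Y : set G) : has_lbound [set d x y | y in Y].
Proof. by exists 0 => _ [y _ <-]; exact: bdist_ge0. Qed.

Lemma excessP A B r : excess A B <= r <->
  forall x, (A : set G) x -> forall e, 0 < e ->
    exists2 y, (B : set G) y & d x y < r + e.
Proof.
split=> [ABr x Ax e e0|h].
  have : inf [set d x y | y in B] < r + e.
    apply: (@le_lt_trans _ _ r); last by rewrite ltrDl.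
    apply: le_trans ABr; apply: ub_le_sup; last by exists x.
    exists 1 => _ [z _ <-]; apply: (@le_trans _ _ (d z 1%g)); last exact: bdist_le1.
    by apply: ge_inf; [exact: has_lb|exists 1%g => //; exact: csubgroup1].
  move=> /inf_lt[]; first by exists (d x 1%g), 1%g => //; exact: csubgroup1.
  by move=> _ [y By <-] ?; exists y.
apply: ge_sup; first by exists (inf [set d 1%g y | y in B]), 1%g => //; exact: csubgroup1.
move=> _ [x Ax <-]; apply/ler_addgt0Pr => e e0.
have [y By xy] := h x Ax e e0.
by apply: le_trans (ltW xy); apply: ge_inf; [exact: has_lb|exists y].
Qed.

Let hdistP A B r : hausdorff_dist A B <= r <-> excess A B <= r /\ excess B A <= r.
Proof. by rewrite /hausdorff_dist ge_max; split=> [/andP|[-> ->]]. Qed.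

Let hdistxx A : hausdorff_dist A A = 0.
Proof.
apply/eqP; rewrite eq_le; apply/andP; split.
  by apply/hdistP; split; apply/excessP => x Ax e e0; exists x; rewrite // bdistxx add0r.
have [/excessP/(_ _ (csubgroup1 A)) h _] := (hdistP A A _).1 (lexx _).
apply/ler_addgt0Pr => e e0; have [y _] := h e e0.
by move=> /ltW; apply: le_trans; exact: bdist_ge0.
Qed.

Let hdistC A B : hausdorff_dist A B = hausdorff_dist B A.
Proof. by rewrite /hausdorff_dist maxC. Qed.

Let excess_triangle B A C : excess A C <= excess A B + excess B C.
Proof.
apply/excessP => x Ax e e0; have e20 : 0 < e / 2 by rewrite divr_gt0.
have [y By xy] := (excessP A B _).1 (lexx _) x Ax _ e20.
have [z Cz yz] := (excessP B C _).1 (lexx _) y By _ e20.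
exists z => //; apply: le_lt_trans (bdist_triangle d y _ _) _.
by rewrite [e in ltRHS]splitr addrACA ltrD.
Qed.

Let hdist_triangle B A C :
  hausdorff_dist A C <= hausdorff_dist A B + hausdorff_dist B C.
Proof.
have [AB BA] := (hdistP A B _).1 (lexx _).
have [BC CB] := (hdistP B C _).1 (lexx _).
apply/hdistP; split; apply: le_trans (excess_triangle B _ _) _; first exact: lerD.
by rewrite addrC lerD.
Qed.

Let excess_sub A B : excess A B <= 0 -> (A : set G) `<=` B.
Proof.
move=> /excessP AB x Ax.
have /closure_id -> : closed (B : set G).
  apply: compact_closed; last exact: csubgroup_compact.
  exact: (bdist_hausdorff d).
move=> X /(bdist_nbhs d)[e e0 eX].
have [y By xy] := AB x Ax e e0; rewrite add0r in xy.
by exists y; split => //; exact: eX.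
Qed.

Let hdist_eq0 A B : hausdorff_dist A B = 0 -> A = B.
Proof.
move=> AB0; have [AB BA] : excess A B <= 0 /\ excess B A <= 0.
  by apply/hdistP; rewrite AB0.
by apply: csubgroup_inj; apply/seteqP; split; exact: excess_sub.
Qed.

HB.instance Definition _ := gen_eqMixin (subgroup_space d).
HB.instance Definition _ := gen_choiceMixin (subgroup_space d).
HB.instance Definition _ := @isMetric.Build R (subgroup_space d)
  (fun A B => hausdorff_dist (csubgroup_set A) (csubgroup_set B))
  hdistxx hdist_eq0 hdistC hdist_triangle.
End HausdorffMetric.

Definition comeager (T : topologicalType) (A : set T) : Prop :=
  exists F : (set T)^nat,
    (forall i, open (F i) /\ dense (F i)) /\ \bigcap_i F i `<=` A.

Section Smooth.
Context (R : realType) (V W : normedModType R).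

(* f is of class C^k on the open set D: all its iterated directional
   derivatives of order at most k exist and are continuous on D *)
Fixpoint classC (k : nat) (D : set V) (f : V -> W) : Prop :=
  {in D, continuous f} /\
  if k is k'.+1 then
    forall v, (forall x, D x -> derivable f x v) /\ classC k' D ('D_v f)
  else True.

Definition smooth (D : set V) (f : V -> W) : Prop := forall k, classC k D f.
End Smooth.

(* chart_inv is only meaningful on the image of chart_dom *)
Record chart (R : realType) (T : topologicalType) (m : nat) := Chart {
  chart_dom : set T;
  chart_map :> T -> 'rV[R]_m;
  chart_inv : 'rV[R]_m -> T;
  chart_dom_open : open chart_dom;
  chart_cod_open : open (chart_map @` chart_dom);
  chart_mapK : {in chart_dom, cancel chart_map chart_inv};
  chart_map_continuous : {within chart_dom, continuous chart_map};
  chart_inv_continuous : {within chart_map @` chart_dom, continuous chart_inv}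
}.

Definition smooth_atlas (R : realType) (T : topologicalType) (m : nat)
    (A : set (chart R T m)) : Prop :=
  (forall x, exists2 c, A c & chart_dom c x) /\
  forall c c', A c -> A c' ->
    smooth (c @` (chart_dom c `&` chart_dom c')) (c' \o chart_inv c).

Section LieGroup.
Context (R : realType) (G : topGroupType).

Definition smooth_mul (m : nat) (A : set (chart R G m)) : Prop :=
  forall c1 c2 c3, A c1 -> A c2 -> A c3 ->
    smooth
      [set (c1 p.1, c2 p.2) | p in
        [set p : G * G | [/\ chart_dom c1 p.1, chart_dom c2 p.2
                           & chart_dom c3 (p.1 * p.2)%g]]]
      (fun u : 'rV[R]_m * 'rV[R]_m => c3 (chart_inv c1 u.1 * chart_inv c2 u.2)%g).

Definition smooth_inv (m : nat) (A : set (chart R G m)) : Prop :=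
  forall c c', A c -> A c' ->
    smooth (c @` [set x : G | chart_dom c x /\ chart_dom c' (x^-1)%g])
      (fun u => c' (chart_inv c u)^-1%g).

(* real, finite-dimensional; the dimension m may be zero *)
Definition is_lie_group : Prop :=
  [/\ hausdorff_space G, second_countable (T := G) &
      exists (m : nat) (A : set (chart R G m)),
        [/\ smooth_atlas A, smooth_mul A & smooth_inv A]].
End LieGroup.

(* k : nat stands for n = k + 1, so that n ranges over the positive integers *)
Definition SUprod (R : realType) : topGroupType :=
  prod_topology (fun k : nat => SU R k.+1).

Definition identity_component_group (G : topGroupType) (H : compact_subgroup G) :
    topGroupType :=
  subgroup_type (identity_component_subgroup (csubgroupP H)).

(* Main.v *)
(** A Lie group has no small subgroups: in a chart around 1 the squaring map is
    u |-> 2u + o(u), so the squares of an element close to 1 move away from 1.  It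
    therefore suffices that generically the identity component of G meets the
    tails [1 x ... x 1 x SU(n) x SU(n+1) x ...] in nontrivial subgroups.

    The subgroups containing a factor SU(n) with n large are dense, because
    multiplying G by that normal factor moves it by at most 2^-n; the generic
    subgroups are those lying, for infinitely many n, very close to one of them.
    If G is that close, every s in SU(n) is approximated by the n-th coordinate of
    some x in G whose earlier coordinates are close to 1.  Commutators with such
    elements, for s a small rotation, shrink the earlier coordinates much faster
    than the n-th one; repeated squaring then brings the n-th coordinate back to a
    prescribed small size, and compactness yields elements of G with trivial
    earlier coordinates and n-th coordinate nontrivial but arbitrarily close to 1.
    Hence there are z in the tail of G as close to 1 as desired with nontrivial n-th
    coordinate.  SU(n) has no small subgroups, so the powers of z form chains with
    arbitrarily small steps from 1 to a fixed closed set avoiding 1, and by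
    compactness the component of 1 in the tail of G reaches that set. *)

Require Import Defs.
From HB Require Import structures.
From mathcomp Require Import all_boot all_order all_algebra.
From mathcomp Require Import spectral complex.
From mathcomp Require Import all_classical all_reals all_analysis.
From mathcomp Require Import ring lra.

Set Implicit Arguments.
Unset Strict Implicit.
Unset Printing Implicit Defensive.

Import Order.TTheory GRing.Theory Num.Theory.
Import numFieldNormedType.Exports Normc.

Local Open Scope classical_set_scope.
Local Open Scope ring_scope.

(** * The l1 norm of complex matrices *)

Section EntryNorm.
Variable R : realType.
Implicit Types m n p : nat.

Definition l1norm m n (A : 'M[R[i]]_(m, n)) : R := \sum_i \sum_j normc (A i j).

Lemma normc_ge0 (z : R[i]) : 0 <= normc z.
Proof. by case: z => a b; rewrite sqrtr_ge0. Qed.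

Lemma normc_norm (z : R[i]) : `|z| = (normc z)%:C%C.
Proof. by case: z. Qed.

Lemma l1norm_ge0 m n (A : 'M[R[i]]_(m, n)) : 0 <= l1norm A.
Proof. by do 2 (apply: sumr_ge0 => ? _); exact: normc_ge0. Qed.

Lemma normc_le_l1norm m n (A : 'M[R[i]]_(m, n)) i j : normc (A i j) <= l1norm A.
Proof.
rewrite /l1norm (bigD1 i)//= (bigD1 j)//= -addrA lerDl addr_ge0//.
  by apply: sumr_ge0 => ? _; exact: normc_ge0.
by do 2 (apply: sumr_ge0 => ? _); exact: normc_ge0.
Qed.

Lemma l1norm0 m n : l1norm (0 : 'M[R[i]]_(m, n)) = 0.
Proof. by do 2 (apply: big1 => ? _); rewrite mxE normc0. Qed.

Lemma l1norm_eq0 m n (A : 'M[R[i]]_(m, n)) : l1norm A = 0 -> A = 0.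
Proof.
move=> A0; apply/matrixP => i j; rewrite mxE; apply: eq0_normc.
by apply/eqP; rewrite eq_le normc_ge0 andbT -A0 normc_le_l1norm.
Qed.

Lemma l1normN m n (A : 'M[R[i]]_(m, n)) : l1norm (- A) = l1norm A.
Proof. by do 2 (apply: eq_bigr => ? _); rewrite mxE normcN. Qed.

Lemma l1normD m n (A B : 'M[R[i]]_(m, n)) : l1norm (A + B) <= l1norm A + l1norm B.
Proof.
rewrite /l1norm -big_split/=; apply: ler_sum => i _; rewrite -big_split/=.
by apply: ler_sum => j _; rewrite mxE le_normcD.
Qed.

Lemma l1normB m n (A B : 'M[R[i]]_(m, n)) : l1norm (A - B) <= l1norm A + l1norm B.
Proof. by rewrite -(l1normN B); exact: l1normD. Qed.

Lemma l1norm_distC m n (A B : 'M[R[i]]_(m, n)) : l1norm (A - B) = l1norm (B - A).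
Proof. by rewrite -l1normN opprB. Qed.

Lemma l1norm_triangle m n (B A C : 'M[R[i]]_(m, n)) :
  l1norm (A - C) <= l1norm (A - B) + l1norm (B - C).
Proof. by rewrite (_ : A - C = (A - B) + (B - C)) ?l1normD// addrA subrK. Qed.

Lemma l1normZ m n z (A : 'M[R[i]]_(m, n)) : l1norm (z *: A) = normc z * l1norm A.
Proof.
rewrite /l1norm mulr_sumr; apply: eq_bigr => i _; rewrite mulr_sumr.
by apply: eq_bigr => j _; rewrite mxE normcM.
Qed.

Lemma normc_sum (I : Type) (r : seq I) (F : I -> R[i]) :
  normc (\sum_(i <- r) F i) <= \sum_(i <- r) normc (F i).
Proof.
elim: r => [|i r IH]; first by rewrite !big_nil normc0.
by rewrite !big_cons; apply: le_trans (le_normcD _ _) _; rewrite lerD2l.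
Qed.

Lemma l1normM m n p (A : 'M[R[i]]_(m, n)) (B : 'M[R[i]]_(n, p)) :
  l1norm (A *m B) <= l1norm A * l1norm B.
Proof.
rewrite /l1norm mulr_suml; apply: ler_sum => i _.
apply: (@le_trans _ _ (\sum_j \sum_k normc (A i k) * normc (B k j))).
  apply: ler_sum => j _; rewrite mxE; apply: le_trans (normc_sum _ _) _.
  by apply: ler_sum => k _; rewrite normcM.
rewrite exchange_big/= mulr_suml; apply: ler_sum => k _.
rewrite -mulr_sumr; apply: ler_wpM2l; first exact: normc_ge0.
rewrite (bigD1 k)//= lerDl.
by do 2 (apply: sumr_ge0 => ? _); exact: normc_ge0.
Qed.

Lemma l1norm_delta n (i j : 'I_n) : l1norm (delta_mx i j) = 1.
Proof.
rewrite /l1norm (bigD1 i)//= (bigD1 j)//= mxE !eqxx normc1.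
rewrite big1 ?addr0 => [|k kj]; last by rewrite mxE eqxx (negPf kj) normc0.
rewrite big1 ?addr0// => k ki; apply: big1 => l _.
by rewrite mxE (negPf ki) normc0.
Qed.

Lemma l1norm_comm n (A B : 'M[R[i]]_n) :
  l1norm (A *m B - B *m A) <= 2 * l1norm A * l1norm B.
Proof.
apply: le_trans (l1normB _ _) _.
have := l1normM A B; have := l1normM B A; lra.
Qed.

(** Commutators ignore scalar matrices, so both factors can be centred at 1. The bound becomes
    quadratic near the identity, which is why commutators there are so small. *)
Lemma l1norm_comm1 n (A B : 'M[R[i]]_n) :
  l1norm (A *m B - B *m A) <= 2 * l1norm (A - 1%:M) * l1norm (B - 1%:M).
Proof.
rewrite (_ : A *m B - B *m A =
  (A - 1%:M) *m (B - 1%:M) - (B - 1%:M) *m (A - 1%:M)); first exact: l1norm_comm.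
rewrite !mulmxBl !mulmxBr !mul1mx !mulmx1.
move: (A *m B) (B *m A) => C D; apply/matrixP => i j; rewrite !mxE; ring.
Qed.

Lemma normc_unitary n (U : 'M[R[i]]_n) i j : U \is unitarymx -> normc (U i j) <= 1.
Proof.
move=> /unitarymxP/(congr1 (fun M : 'M[R[i]]_n => M i i)).
rewrite !mxE eqxx (bigD1 j)//= !mxE -normCK => h.
have : `|U i j| ^+ 2 <= 1.
  rewrite -[1]/(true%:R) -h lerDl; apply: sumr_ge0 => k _.
  by rewrite !mxE -normCK exprn_ge0.
by rewrite expr_le1// normc_norm -[1]/((1 : R)%:C%C) lecR.
Qed.

Lemma l1norm_unitary n (U : 'M[R[i]]_n) : U \is unitarymx -> l1norm U <= (n ^ 2)%:R.
Proof.
move=> Uu; apply: (@le_trans _ _ (\sum_(i < n) \sum_(j < n) 1)).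
  by do 2 (apply: ler_sum => ? _); exact: normc_unitary.
rewrite (eq_bigr (fun=> n%:R)) => [|i _]; rewrite sumr_const card_ord//.
by rewrite -mulrnA mulnn.
Qed.

End EntryNorm.

(** * Rotations in a coordinate plane *)

(** [J] plays the projection onto a coordinate plane and [K] the quarter turn in it, so [b] is the
    rotation with cosine [p] and sine [q]. The conclusions are its inverse and the double-angle
    formulas. *)
Lemma rotation_products (T : comNzRingType) n (J K : 'M[T]_n) (p q : T) :
  J *m J = J -> J *m K = K -> K *m J = K -> K *m K = - J -> p * p = 1 - q * q ->
  let b := 1%:M + (p - 1) *: J + q *: K in
  b *m (1%:M + (p - 1) *: J - q *: K) = 1%:M /\
  b *m b = 1%:M - (2 * (q * q)) *: J + (2 * p * q) *: K.
Proof.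
move=> JJ JK KJ KK pq /=.
rewrite !(mulmxDl, mulmxDr, mulmxN, mul1mx, mulmx1) -!scalemxAl -!scalemxAr.
rewrite JJ JK KJ KK; split; apply/matrixP => k l; rewrite !mxE.
all: by move: (J k l) (K k l) ((k == l)%:R) => x y z; ring: pq.
Qed.

Section Rotation.
Variables (R : realType) (n : nat).
Implicit Types (i j k l : 'I_n) (Z : 'M[R[i]]_n).
Local Open Scope sesquilinear_scope.

Definition skewE i j : 'M[R[i]]_n := delta_mx i j - delta_mx j i.
Definition symE i j : 'M[R[i]]_n := delta_mx i i + delta_mx j j.

Lemma l1norm_skewE i j : l1norm (skewE i j) <= 2.
Proof. by apply: le_trans (l1normB _ _) _; rewrite !l1norm_delta. Qed.

Lemma l1norm_symE i j : l1norm (symE i j) <= 2.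
Proof. by apply: le_trans (l1normD _ _) _; rewrite !l1norm_delta. Qed.

Lemma tr_skewE i j : (skewE i j)^T = - skewE i j.
Proof. by rewrite /skewE linearB/= !trmx_delta opprB. Qed.

Lemma tr_symE i j : (symE i j)^T = symE i j.
Proof. by rewrite /symE linearD/= !trmx_delta. Qed.

Lemma conj_realC (x : R) : Num.conj (x%:C%C : R[i]) = x%:C%C.
Proof. by apply: CrealP; apply/complex_realP; exists x. Qed.

Section Products.
Variables (i j : 'I_n) (ij : i != j).

Let ji : j != i. Proof. by rewrite eq_sym. Qed.

Lemma skewE2 : skewE i j *m skewE i j = - symE i j.
Proof.
rewrite /skewE /symE mulmxBl !mulmxBr !mul_delta_mx !mul_delta_mx_0//.
by rewrite sub0r subr0 opprD.
Qed.

Lemma symE2 : symE i j *m symE i j = symE i j.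
Proof.
rewrite /symE mulmxDl !mulmxDr !mul_delta_mx !mul_delta_mx_0//.
by rewrite addr0 add0r.
Qed.

Lemma symE_skewE : symE i j *m skewE i j = skewE i j.
Proof.
rewrite /skewE /symE mulmxDl !mulmxBr !mul_delta_mx !mul_delta_mx_0//.
by rewrite subr0 sub0r.
Qed.

Lemma skewE_symE : skewE i j *m symE i j = skewE i j.
Proof.
rewrite /skewE /symE mulmxBl !mulmxDr !mul_delta_mx !mul_delta_mx_0//.
by rewrite addr0 add0r.
Qed.

(* The square of a real rotation has determinant 1 without any computation. *)
Lemma rotation_SU (q : R) : 0 <= q <= 2^-1 ->
  exists (Q : R) (a : SU R n), q <= Q <= 2 * q /\
    val a = 1%:M - (2 * q ^+ 2)%:C%C *: symE i j + Q%:C%C *: skewE i j.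
Proof.
move=> /andP[q0 q1]; pose p := Num.sqrt (1 - q ^+ 2).
have p2 : p ^+ 2 = 1 - q ^+ 2 by rewrite sqr_sqrtr//; nra.
have p0 : 0 <= p by exact: sqrtr_ge0.
(* These bounds place the witness [Q = 2 p q] between [q] and [2 q]. *)
have [ple pge] : p <= 1 /\ 2^-1 <= p by split; nra.
pose P := p%:C%C : R[i]; pose q' := q%:C%C : R[i].
have P2 : P * P = 1 - q' * q'.
  by rewrite /P /q' -!rmorphM -expr2 p2 rmorphB rmorph1 expr2.
pose b := 1%:M + (P - 1) *: symE i j + q' *: skewE i j.
have bT : b^T = 1%:M + (P - 1) *: symE i j - q' *: skewE i j.
  by rewrite /b 2!linearD/= !linearZ/= trmx1 tr_symE tr_skewE scalerN.
have bJ : b ^ Num.conj = b.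
  have PJ : Num.conj (P - 1) = P - 1 by rewrite rmorphB rmorph1 /P/= conj_realC.
  apply/matrixP => k l; rewrite !mxE !rmorphD/= 2!rmorphM/= PJ /q' conj_realC.
  by rewrite rmorphB rmorphD/= !rmorph_nat.
have [bbT bb2] := rotation_products symE2 symE_skewE skewE_symE skewE2 P2.
have bb : b *m b^T = 1%:M by rewrite bT.
have bu : b \is unitarymx by apply/unitarymxP; rewrite -map_trmx bJ.
have SUbb : special_unitary (b *m b).
  split; first exact: mul_unitarymx.
  by rewrite det_mulmx -{2}(det_tr b) -det_mulmx bb det1.
exists (2 * p * q), (Sub (b *m b) (mem_set SUbb)); split; last first.
  by rewrite /= bb2 /P /q' expr2 !rmorphM rmorph_nat.
by apply/andP; split; nra.
Qed.
End Products.

Lemma mul_mx_deltaE Z i j k l : (Z *m delta_mx i j) k l = Z k i * (l == j)%:R.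
Proof.
rewrite mxE (bigD1 i)//= mxE eqxx big1 ?addr0// => m mi.
by rewrite mxE (negPf mi) mulr0.
Qed.

Lemma mul_delta_mxE Z i j k l : (delta_mx i j *m Z) k l = (k == i)%:R * Z j l.
Proof.
rewrite mxE (bigD1 j)//= mxE eqxx andbT big1 ?addr0// => m mj.
by rewrite mxE (negPf mj) andbF mul0r.
Qed.

Lemma comm_skewE Z i j k l : (Z *m skewE i j - skewE i j *m Z) k l =
  Z k i * (l == j)%:R - Z k j * (l == i)%:R
  - ((k == i)%:R * Z j l - (k == j)%:R * Z i l).
Proof.
by rewrite /skewE mulmxBr mulmxBl !(mul_mx_deltaE, mul_delta_mxE, mxE).
Qed.
End Rotation.

Lemma l1norm_le_entry (R : realType) n (Z : 'M[R[i]]_n.+1) :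
  exists k l, l1norm Z <= (n.+1 ^ 2)%:R * normc (Z k l).
Proof.
pose F (x : 'I_n.+1 * 'I_n.+1) : R := normc (Z x.1 x.2).
have [[k l] _ Fmax] := @Order.TotalTheory.arg_maxP _ _ _ (ord0, ord0) xpredT F isT.
exists k, l; apply: (@le_trans _ _ (\sum_(i < n.+1) \sum_(j < n.+1) normc (Z k l))).
  by do 2 (apply: ler_sum => ? _); exact: (Fmax (_, _)).
rewrite (eq_bigr (fun=> normc (Z k l) *+ n.+1)) => [|i _]; rewrite sumr_const card_ord//.
by rewrite -mulrnA mulnn mulr_natl.
Qed.

(* With an index avoiding k and l at hand, every off-diagonal entry of Z, and
   every diagonal one if Z 0 0 = 0, occurs off the diagonal in a commutator with
   an infinitesimal rotation. *)
Lemma comm_skewE_lower_bound (R : realType) n (Z : 'M[R[i]]_n.+3) : Z 0 0 = 0 ->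
  exists i j k l, [/\ i != j, k != l &
    l1norm Z <= (n.+3 ^ 2)%:R * normc ((Z *m skewE R i j - skewE R i j *m Z) k l)].
Proof.
move=> Z0; have [k [l le]] := l1norm_le_entry Z.
have [kl|kl] := eqVneq k l; last first.
  have [j /[!inE]] : exists j, j \notin [set k; l]%SET.
    apply/existsP; rewrite -negb_forall; apply/negP => /forallP h.
    have : (#|'I_n.+3| <= #|[set k; l]%SET|)%N.
      by rewrite -cardsT; apply/subset_leq_card/fintype.subsetP => x _; exact: h.
    by rewrite card_ord cards2; case: (_ != _).
  rewrite negb_or => /andP[jk jl].
  (* The (k, j) entry of the commutator with the rotation in the plane (l, j) is exactly [Z k l]. *)
  exists l, j, k, j; split => //; [by rewrite eq_sym|by rewrite eq_sym|].
  by rewrite comm_skewE eqxx (negPf jl) (negPf kl) eq_sym (negPf jk)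
             mulr1 mulr0 !mul0r !subr0.
case: _ / kl in le; have [k0|k0] := eqVneq k 0.
  (* The largest entry is then [Z 0 0 = 0], so the norm of [Z] vanishes and any indices will do. *)
  rewrite k0 Z0 normc0 mulr0 in le.
  exists 0, 1, 0, 1; split => //; apply: le_trans le _.
  by rewrite mulr_ge0// normc_ge0.
(* Here the commutator entry is [Z k k - Z 0 0]. *)
exists k, 0, k, 0; split => //; rewrite comm_skewE.
by rewrite !eqxx eq_sym (negPf k0) Z0 mulr1 !mulr0 mul0r !subr0.
Qed.

(** * Commutators in SU(n) *)

Lemma normc_real (R : realType) (x : R) : normc (x%:C%C) = `|x|.
Proof. by rewrite /= expr0n addr0 sqrtr_sqr. Qed.

Lemma comm_subr1 (T : comNzRingType) n (Z A : 'M[T]_n) :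
  Z *m A - A *m Z = Z *m (A - 1%:M) - (A - 1%:M) *m Z.
Proof.
rewrite mulmxBl mulmxBr mul1mx mulmx1.
by move: (_ *m _) (_ *m _) => X Y; apply/matrixP => x y; rewrite !mxE; ring.
Qed.

Lemma comm_sub_scalar (T : comNzRingType) n (S A : 'M[T]_n) z :
  (S - z%:M) *m A - A *m (S - z%:M) = S *m A - A *m S.
Proof.
rewrite mulmxBl mulmxBr scalar_mxC.
by move: (_ *m _) (_ *m _) (_ *m _) => X Y W; apply/matrixP => x y; rewrite !mxE; ring.
Qed.

(** Isolates the linear term [w [Z, K]]. The three remaining terms are the errors caused by [W]
    differing from 1, by [A] differing from the exact rotation [A0], and by the cosine part [u J] of
    [A0]. *)
Lemma comm_rotation_expansion (T : comNzRingType) n (Z A A0 J K W : 'M[T]_n) (u w : T) :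
  A0 = 1%:M - u *: J + w *: K ->
  (Z *m A - A *m Z) *m W - w *: (Z *m K - K *m Z) =
  (Z *m A - A *m Z) *m (W - 1%:M) + (Z *m (A - A0) - (A - A0) *m Z)
    - u *: (Z *m J - J *m Z).
Proof.
move=> ->; rewrite (mulmxBr (Z *m A - A *m Z)) mulmx1.
move: ((Z *m A - A *m Z) *m W) => DW.
rewrite !(mulmxDl, mulmxDr, mulmxN, mulNmx, mul1mx, mulmx1, opprD, opprK).
rewrite -!scalemxAl -!scalemxAr.
move: (Z *m A) (A *m Z) (Z *m J) (J *m Z) (Z *m K) (K *m Z).
by move=> *; apply/matrixP => x y; rewrite !mxE; ring.
Qed.

Section SpecialUnitaryNorm.
Variable R : realType.

Definition dist1 n (s : SU R n) : R := l1norm (val s - 1%:M).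

(** Stands for the distance to the scalar matrices. Subtracting this particular scalar makes the (0,
    0) entry vanish, the normalization assumed in [comm_skewE_lower_bound]. *)
Definition scalar_dist n (s : SU R n.+1) : R := l1norm (val s - (val s 0 0)%:M).

Lemma val_mulSU n (s t : SU R n) : val (s * t)%g = val s *m val t.
Proof. by []. Qed.

Lemma val_oneSU n : val (1%g : SU R n) = 1%:M.
Proof. by []. Qed.

Lemma val_mulSUV n (s : SU R n) : val s *m val s^-1%g = 1%:M.
Proof. by rewrite -val_mulSU mulgV. Qed.

Lemma SU_unitary n (s : SU R n) : val s \is unitarymx.
Proof. by have [] := set_mem (valP s). Qed.

Lemma l1norm_SU n (s : SU R n) : l1norm (val s) <= (n ^ 2)%:R.
Proof. exact/l1norm_unitary/SU_unitary. Qed.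

Lemma dist1_ge0 n (s : SU R n) : 0 <= dist1 s.
Proof. exact: l1norm_ge0. Qed.

Lemma dist1_1 n : dist1 (1%g : SU R n) = 0.
Proof. by rewrite /dist1 val_oneSU subrr l1norm0. Qed.

Lemma dist1_eq0 n (s : SU R n) : dist1 s = 0 -> s = 1%g.
Proof. by move=> /l1norm_eq0/eqP; rewrite subr_eq0 => /eqP s1; exact: val_inj. Qed.

Lemma dist1_div n (s t : SU R n) : dist1 (s / t)%g <= (n ^ 2)%:R * l1norm (val s - val t).
Proof.
rewrite /dist1 val_mulSU -(val_mulSUV t) -mulmxBl mulrC.
by apply: le_trans (l1normM _ _) _; rewrite ler_wpM2l ?l1norm_ge0// l1norm_SU.
Qed.

Lemma dist1V n (s : SU R n) : dist1 s^-1%g <= (n ^ 2)%:R * dist1 s.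
Proof. by have := dist1_div 1%g s; rewrite mul1g l1norm_distC. Qed.

Lemma dist1M n (s t : SU R n) : dist1 (s * t)%g <= dist1 s + dist1 t + dist1 s * dist1 t.
Proof.
rewrite {1}/dist1 val_mulSU (_ : _ - _ = (val s - 1%:M) + (val t - 1%:M)
  + (val s - 1%:M) *m (val t - 1%:M)).
  apply: le_trans (l1normD _ _) _; apply: lerD; first exact: l1normD.
  exact: l1normM.
rewrite mulmxBl !mulmxBr !mul1mx mulmx1.
by move: (_ *m _) => X; apply/matrixP => i j; rewrite !mxE; ring.
Qed.

Lemma dist1_sqr_le n (s : SU R n) : dist1 (s * s)%g <= 2 * dist1 s + dist1 s ^+ 2.
Proof. by have := dist1M s s; lra. Qed.

(** From s^2 - 1 = 2 (s - 1) + (s - 1)^2: squaring nearly doubles a small distance to 1. *)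
Lemma dist1_sqr_ge n (s : SU R n) : 2 * dist1 s - dist1 s ^+ 2 <= dist1 (s * s)%g.
Proof.
have e : (val s - 1%:M) + (val s - 1%:M) =
    (val (s * s)%g - 1%:M) - (val s - 1%:M) *m (val s - 1%:M).
  rewrite val_mulSU mulmxBl !mulmxBr !mul1mx mulmx1.
  by move: (_ *m _) => X; apply/matrixP => i j; rewrite !mxE; ring.
have h : l1norm ((val s - 1%:M) + (val s - 1%:M)) = 2 * dist1 s.
  by rewrite -mulr2n -scaler_nat l1normZ -(rmorph_nat (real_complex R)) normc_real normr_nat.
have := l1normB (val (s * s)%g - 1%:M) ((val s - 1%:M) *m (val s - 1%:M)).
by rewrite -e h; have := l1normM (val s - 1%:M) (val s - 1%:M); rewrite /dist1; lra.
Qed.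

(** Written as a quotient so that in SU(n) subtracting 1 leaves the matrix commutator [s a - a s]
    times a unitary matrix. *)
Definition cmt (G : groupType) (s a : G) : G := ((s * a) / (a * s))%g.

Lemma dist1_cmt n (s a : SU R n) : dist1 (cmt s a) <= 2 * (n ^ 2)%:R * dist1 s * dist1 a.
Proof.
apply: le_trans (dist1_div _ _) _; rewrite !val_mulSU [X in _ <= X]mulrC.
have := @l1norm_comm1 R n (val s) (val a).
move=> /(ler_wpM2l (ler0n R (n ^ 2))) => h; apply: le_trans h _.
by rewrite /dist1; lra.
Qed.
End SpecialUnitaryNorm.

Section CommutatorStep.
Variables (R : realType) (n : nat).
Let N := n.+3.

(* [angle] is the size of the rotations we take commutators with: the linear term
   of such a commutator has an off-diagonal entry of size at least
   angle * scalar_dist s / unitary_bound, twice the error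
   220 * unitary_bound * angle ^+ 2 * scalar_dist s.  The first two
   constants are locked because conversion would otherwise unfold 440%:R. *)
Definition unitary_bound : R := locked (N ^ 2)%:R.
Definition angle : R := locked (440 * unitary_bound ^+ 2)^-1.
(** The quotient of the two bounds available for a commutator with a rotation: [14 * unitary_bound *
    angle * scalar_dist s] from above on its distance to 1, and [angle * scalar_dist s / (2 *
    unitary_bound)] from below on its distance to the scalars. Hence noncentrality passes to the
    commutator. *)
Definition ratio_bound : R := 28 * unitary_bound ^+ 2.
Definition shrink : R := angle / (2 * unitary_bound * ratio_bound).

(* Being far from the scalar matrices relative to its distance to 1 is what keeps
   the commutators of s with rotations from degenerating. *)
Definition noncentral (s : SU R N) :=
  dist1 s <= 7 * angle /\ dist1 s <= ratio_bound * scalar_dist s.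

Lemma unitary_boundE : unitary_bound = (N ^ 2)%:R.
Proof. by rewrite /unitary_bound -lock. Qed.

Lemma unitary_bound_ge : 9 <= unitary_bound.
Proof. by rewrite unitary_boundE ler_nat; apply: (@leq_trans (3 ^ 2)); rewrite // leq_exp2r. Qed.

Lemma unitary_bound_gt0 : 0 < unitary_bound.
Proof. by apply: lt_le_trans unitary_bound_ge; rewrite ltr0n. Qed.

Lemma ratio_bound_gt0 : 0 < ratio_bound.
Proof. by apply: mulr_gt0; [rewrite ltr0n|exact: exprn_gt0 unitary_bound_gt0]. Qed.

Lemma angle_gt0 : 0 < angle.
Proof.
rewrite /angle -lock invr_gt0.
by apply: mulr_gt0; [rewrite ltr0n|exact: exprn_gt0 unitary_bound_gt0].
Qed.

Lemma angleE : angle * (440 * unitary_bound ^+ 2) = 1.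
Proof.
have := angle_gt0; rewrite /angle -lock invr_gt0 => h.
exact: mulVf (lt0r_neq0 h).
Qed.

Lemma angle_le : 440 * 9 * 9 * angle <= 1.
Proof.
have C9 := unitary_bound_ge; have q0 := ltW angle_gt0.
have h : 9 * 9 <= unitary_bound ^+ 2 by rewrite expr2; apply: (ler_pM _ _ C9 C9); rewrite ler0n.
by have := ler_wpM2l q0 h; have := angleE; lra.
Qed.

Lemma CCB_gt0 : 0 < 2 * unitary_bound * ratio_bound.
Proof. exact: mulr_gt0 (mulr_gt0 (ltr0n _ 2) unitary_bound_gt0) ratio_bound_gt0. Qed.

Lemma shrink_gt0 : 0 < shrink.
Proof. exact: divr_gt0 angle_gt0 CCB_gt0. Qed.

Lemma shrinkE : shrink * (2 * unitary_bound * ratio_bound) = angle.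
Proof. exact: divfK (lt0r_neq0 CCB_gt0) _. Qed.

Lemma offdiag_le_scalar_dist (t : SU R N) k l : k != l -> normc (val t k l) <= scalar_dist t.
Proof.
move=> kl; apply: le_trans (normc_le_l1norm _ k l).
by rewrite !mxE (negPf kl) mulr0n subr0.
Qed.

Lemma offdiag_le_dist1 (t : SU R N) k l : k != l -> normc (val t k l) <= dist1 t.
Proof.
move=> kl; apply: le_trans (normc_le_l1norm _ k l).
by rewrite !mxE (negPf kl) mulr0n subr0.
Qed.

Lemma near_rotation (a0 a : SU R N) (Q : R) i j : angle <= Q <= 2 * angle ->
  val a0 = 1%:M - (2 * angle ^+ 2)%:C%C *: symE R i j + Q%:C%C *: skewE R i j ->
  l1norm (val a - val a0) <= angle ^+ 2 -> dist1 a <= 7 * angle.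
Proof.
move=> /andP[Q1 Q2] a0E aa0; have q0 := angle_gt0; have qle := angle_le.
have := l1norm_triangle (val a0) (val a) 1%:M; rewrite -/(dist1 a).
have : l1norm (val a0 - 1%:M) <= 4 * angle ^+ 2 + 2 * Q.
  rewrite a0E (_ : _ - 1%:M = Q%:C%C *: skewE R i j - (2 * angle ^+ 2)%:C%C *: symE R i j).
    apply: le_trans (l1normB _ _) _; rewrite !l1normZ !normc_real.
    rewrite !ger0_norm//; [|by nra|by nra].
    by have := l1norm_skewE R i j; have := l1norm_symE R i j; nra.
  by apply/matrixP => k l; rewrite !mxE; ring.
nra.
Qed.

(** A rotation in the plane (0, 1) has an off-diagonal entry of size at least [angle], and an error
    of [angle ^+ 2] leaves at least half of it. The error is allowed because a subgroup close to one
    containing the factor provides only approximations of [a0]. *)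
Lemma noncentral_start : exists a0 : SU R N, forall a, l1norm (val a - val a0) <= angle ^+ 2 ->
  noncentral a /\ 0 < dist1 a.
Proof.
have q0 := angle_gt0; have qle := angle_le; have C9 := unitary_bound_ge.
have [|Q [a0 [Qq a0E]]] := @rotation_SU R N 0 1 isT angle; first by apply/andP; split; lra.
exists a0 => a aa0; have na7 := near_rotation Qq a0E aa0.
have /andP[Q1 Q2] := Qq.
have a01 : val a0 0 1 = Q%:C%C.
  by rewrite a0E !mxE/=; ring.
have h : Q - angle ^+ 2 <= normc (val a 0 1).
  have := normc_le_l1norm (val a - val a0) 0 1; rewrite !mxE a01 => h.
  have := le_normcD (val a 0 1) (Q%:C%C - val a 0 1).
  rewrite addrC subrK -[normc (Q%:C%C - _)]normcN opprB normc_real ger0_norm; last lra.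
  by lra.
have h1 := @offdiag_le_scalar_dist a 0 1 isT; have h2 := @offdiag_le_dist1 a 0 1 isT.
split; last by nra.
split; first by [].
have h3 : angle / 2 <= scalar_dist a by nra.
have h4 : 14 <= ratio_bound by rewrite /ratio_bound; nra.
have r0 : 0 <= scalar_dist a by lra.
by have := ler_wpM2r r0 h4; lra.
Qed.

(** [a0] is a rotation in the plane chosen by [comm_skewE_lower_bound]. The linear term of the
    commutator dominates the error at an off-diagonal entry (k, l), and that single entry bounds
    from below both the distance to 1 and the distance to the scalars. *)
Lemma noncentral_step (s : SU R N) : noncentral s ->
  exists a0 : SU R N, forall a, l1norm (val a - val a0) <= angle ^+ 2 ->
    [/\ noncentral (cmt s a), shrink * dist1 s <= dist1 (cmt s a) & dist1 (cmt s a) <= dist1 s / 2].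
Proof.
move=> [s7 sB]; have q0 := angle_gt0; have qle := angle_le; have C9 := unitary_bound_ge.
have [Z ZE] : {Z : 'M[R[i]]_N | Z = val s - (val s 0 0)%:M} by eexists.
have rZ : scalar_dist s = l1norm Z by rewrite ZE.
have Z0 : Z 0 0 = 0 by rewrite ZE !mxE mulr1n subrr.
have r0 : 0 <= scalar_dist s by exact: l1norm_ge0.
have [i [j [k [l [ij kl]]]]] := comm_skewE_lower_bound Z0.
rewrite -rZ -unitary_boundE.
set K := skewE R i j; set c := normc _ => lb.
have [|Q [a0 [Qq a0E]]] := @rotation_SU R N i j ij angle; first by apply/andP; split; lra.
exists a0 => a aa0; have a7 := near_rotation Qq a0E aa0.
have /andP[Q1 Q2] := Qq.
pose J := symE R i j.
pose D := Z *m val a - val a *m Z.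
have Dle : l1norm D <= 14 * angle * scalar_dist s.
  rewrite /D comm_subr1.
  apply: le_trans (l1norm_comm _ _) _; rewrite -rZ -/(dist1 a); nra.
pose W : 'M[R[i]]_N := val (a * s)^-1%g.
(* [Z] and [s] differ by a scalar matrix, so they have the same commutator with [a]. *)
have tE : val (cmt s a) - 1%:M = D *m W.
  by rewrite /D ZE comm_sub_scalar /W mulmxBl -!val_mulSU mulgV.
have Wle : l1norm (W - 1%:M) <= unitary_bound * (15 * angle).
  apply: le_trans (dist1V (a * s)%g) _; rewrite -unitary_boundE.
  rewrite ler_pM2l; last exact: unitary_bound_gt0.
  by have := dist1M a s; have := dist1_ge0 a; have := dist1_ge0 s; nra.
pose E := val (cmt s a) - 1%:M - Q%:C%C *: (Z *m K - K *m Z).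
(* In units of [scalar_dist s * angle ^+ 2] the three errors are at most [210 * unitary_bound], 2
   and 8. *)
have Ele : l1norm E <= 220 * unitary_bound * scalar_dist s * angle ^+ 2.
  have -> : E = D *m (W - 1%:M) + (Z *m (val a - val a0) - (val a - val a0) *m Z)
      - (2 * angle ^+ 2)%:C%C *: (Z *m J - J *m Z).
    by rewrite /E tE; exact: comm_rotation_expansion.
  have q2 := sqr_ge0 angle; have q20 : 0 <= 2 * angle ^+ 2 by exact: mulr_ge0 (ler0n _ 2) q2.
  have h1 : l1norm (D *m (W - 1%:M)) <= 14 * angle * scalar_dist s * (unitary_bound * (15 * angle)).
    exact: le_trans (l1normM _ _) (ler_pM (l1norm_ge0 _) (l1norm_ge0 _) Dle Wle).
  have h2 : l1norm (Z *m (val a - val a0) - (val a - val a0) *m Z)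
      <= 2 * scalar_dist s * angle ^+ 2.
    apply: le_trans (l1norm_comm _ _) _; rewrite -rZ.
    exact: ler_wpM2l (mulr_ge0 (ler0n _ 2) r0) _ _ aa0.
  have h3 : l1norm ((2 * angle ^+ 2)%:C%C *: (Z *m J - J *m Z))
      <= 2 * angle ^+ 2 * (4 * scalar_dist s).
    rewrite l1normZ normc_real ger0_norm//; apply: ler_wpM2l q20 _ _ _.
    apply: le_trans (l1norm_comm _ _) _; rewrite -rZ.
    by have := l1norm_symE R i j; rewrite -/J; clear - r0; nra.
  apply: le_trans (l1normB _ _) _; apply: le_trans (lerD (l1normD _ _) (lexx _)) _.
  have h4 := mulr_ge0 r0 q2; have h5 := ler_wpM2l h4 C9.
  move: h1 h2 h3 h4 h5; clear; lra.
clear a0E ZE Z0 Wle aa0.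
have C2 : 0 <= 2 * unitary_bound by lra.
(* Off the diagonal the identity matrix contributes nothing, and by [angleE] the error [E] uses up
   at most half of the bound for the linear term. *)
have tkl : angle * scalar_dist s / (2 * unitary_bound) <= normc (val (cmt s a) k l).
  have := le_normcD (val (cmt s a) k l) (- E k l).
  have -> : val (cmt s a) k l + - E k l = Q%:C%C * ((Z *m K - K *m Z) k l).
    rewrite /E; move: (Z *m K - K *m Z) => X; rewrite !mxE (negPf kl) mulr0n; ring.
  rewrite normcN normcM normc_real ger0_norm; last lra.
  rewrite -/c; have := normc_le_l1norm E k l => h1 h2.
  have c0 : 0 <= c by exact: normc_ge0.
  have h3 : angle * c <= Q * c by exact: ler_wpM2r c0 _ _ Q1.
  rewrite ler_pdivrMr; last lra.
  have h4 : angle * scalar_dist s <= angle * (unitary_bound * c) by rewrite (ler_pM2l q0).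
  have h5 : angle * c - 220 * unitary_bound * scalar_dist s * angle ^+ 2
      <= normc (val (cmt s a) k l) by lra.
  have h6 : (angle * c - 220 * unitary_bound * scalar_dist s * angle ^+ 2) * (2 * unitary_bound)
      <= normc (val (cmt s a) k l) * (2 * unitary_bound) by exact: ler_wpM2r C2 _ _ h5.
  apply: le_trans h6.
  have -> : (angle * c - 220 * unitary_bound * scalar_dist s * angle ^+ 2) * (2 * unitary_bound) =
     2 * (angle * (unitary_bound * c)) - (angle * (440 * unitary_bound ^+ 2))
       * (angle * scalar_dist s) by ring.
  by rewrite angleE; lra.
have ntle : dist1 (cmt s a) <= 14 * unitary_bound * angle * scalar_dist s.
  rewrite /dist1 tE; apply: le_trans (l1normM _ _) _.
  apply: (@le_trans _ _ (14 * angle * scalar_dist s * unitary_bound)); last by lra.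
  by apply: (ler_pM _ _ Dle _); [exact: l1norm_ge0|exact: l1norm_ge0|
    rewrite unitary_boundE; exact: l1norm_SU].
have nhalf : dist1 (cmt s a) <= dist1 s / 2.
  apply: le_trans (dist1_cmt s a) _; rewrite -unitary_boundE.
  have h : unitary_bound * angle * 440 * unitary_bound = 1 by have := angleE; lra.
  have h' : 0 <= unitary_bound * angle by exact: mulr_ge0 (ltW unitary_bound_gt0) (ltW q0).
  have h'' : unitary_bound * angle <= 440^-1 * 9^-1 by nra.
  have := dist1_ge0 s => ns0.
  have h7 : unitary_bound * dist1 a <= 7 * (unitary_bound * angle) by nra.
  have : (unitary_bound * dist1 a) * dist1 s <= 4^-1 * dist1 s by apply: (ler_wpM2r ns0); lra.
  by lra.
have trho : 14 * unitary_bound * angle * scalar_dist s <= ratio_bound * scalar_dist (cmt s a).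
  have := offdiag_le_scalar_dist (cmt s a) kl => h.
  have h1 : ratio_bound * (angle * scalar_dist s / (2 * unitary_bound))
      <= ratio_bound * scalar_dist (cmt s a).
    by rewrite ler_pM2l; [lra|exact: ratio_bound_gt0].
  have XE : angle * scalar_dist s / (2 * unitary_bound) * (2 * unitary_bound)
      = angle * scalar_dist s.
    exact: divfK (lt0r_neq0 (mulr_gt0 (ltr0n _ 2) unitary_bound_gt0)) _.
  apply: le_trans h1; rewrite /ratio_bound.
  have -> : 14 * unitary_bound * angle * scalar_dist s =
      14 * unitary_bound * (angle * scalar_dist s) by ring.
  move: XE; move: (angle * scalar_dist s / (2 * unitary_bound)) => X <-.
  by rewrite le_eqVlt; apply/orP; left; apply/eqP; ring.
split; last exact: nhalf.
  split; last exact: le_trans ntle trho.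
  by have := dist1_ge0 s; lra.
apply: le_trans (offdiag_le_dist1 _ kl); apply: le_trans tkl.
rewrite ler_pdivlMr; last lra.
have c0 := shrink_gt0.
have := ler_wpM2l (ltW c0) sB => h.
have h1 : shrink * dist1 s * (2 * unitary_bound)
    <= shrink * (ratio_bound * scalar_dist s) * (2 * unitary_bound) by exact: ler_wpM2r C2 _ _ h.
by apply: le_trans h1 _; rewrite -shrinkE; lra.
Qed.
End CommutatorStep.

(** * Cluster points and continuity of the distance to 1 *)

Section Cluster.

Definition seq_cluster (T : topologicalType) (y : nat -> T) (p : T) :=
  forall U, nbhs p U -> forall j0, exists2 j, (j0 <= j)%N & U (y j).

Lemma compact_seq_cluster (T : topologicalType) (A : set T) (y : nat -> T) :
  compact A -> (forall j, A (y j)) -> exists2 p, A p & seq_cluster y p.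
Proof.
move=> cA Ay; have [|p [Ap yp]] := cA (y @ \oo) _.
  by exists 0%N => // j _; exact: Ay.
exists p => // U pU j0.
have [|_ [[j j0j <-] Uj]] := yp [set y j | j in [set j | (j0 <= j)%N]] U _ pU.
  by exists j0 => // j j0j; exists j.
by exists j.
Qed.

Lemma seq_cluster_le (R : realType) (T : topologicalType) (y : nat -> T) p
    (f : T -> R) (b : R) : seq_cluster y p -> {for p, continuous f} ->
  (forall e, 0 < e -> exists j0, forall j, (j0 <= j)%N -> f (y j) <= b + e) -> f p <= b.
Proof.
move=> yp fc h; apply/ler_addgt0Pr => e e0.
have e20 : 0 < e / 2 by rewrite divr_gt0.
have [j0 hj0] := h _ e20.
have nU : nbhs p [set z | `|f p - f z| < e / 2].
  by have /cvgrPdist_lt/(_ _ e20) := fc.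
have [j /hj0 h1 /= h2] := yp _ nU j0.
by have := ler_norm (f p - f (y j)); lra.
Qed.
End Cluster.

Section NormContinuity.
Variable R : realType.

Lemma normc_cvg (T : Type) (F : set_system T) (FF : Filter F) (f : T -> R[i]) (z : R[i]) :
  f @ F --> z -> (fun t => normc (f t)) @ F --> normc z.
Proof.
move=> fz; apply/cvgrPdist_lt => e e0.
have e0' : 0 < e%:C%C :> R[i] by rewrite ltcR.
have := (@cvgrPdist_lt R[i] R[i]^o T F FF f z).1 fz _ e0'.
apply: filterS => t /=; rewrite normc_norm ltcR => h; apply: le_lt_trans h.
rewrite ler_norml; apply/andP; split.
  rewrite lerNl opprB lerBlDr -(normcN (z - f t)) opprB; apply: le_trans (le_normcD _ _).
  by rewrite subrK.
by rewrite lerBlDr; apply: le_trans (le_normcD _ _); rewrite subrK.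
Qed.

Lemma val_SU_cvg n (s : SU R n) (i j : 'I_n) :
  (fun t : SU R n => (val t) i j : R[i]) @ s --> (val s) i j.
Proof.
apply: (@cvg_comp _ _ _ (val : SU R n -> 'M[R[i]]_n) (fun M => M i j)).
  exact: initial_continuous.
exact: (@coord_continuous R[i] n n i j).
Qed.

Lemma l1norm_subr_continuous n (A : 'M[R[i]]_n) :
  continuous (fun s : SU R n => l1norm (val s - A)).
Proof.
move=> s; rewrite /l1norm.
apply: (@cvg_big R _ +%R 0 xpredT (@add_continuous R) _ _ _ _ _ (nbhs_filter s)) => i _.
apply: (@cvg_big R _ +%R 0 xpredT (@add_continuous R) _ _ _ _ _ (nbhs_filter s)) => j _.
apply: (normc_cvg (nbhs_filter s)).
under eq_fun do rewrite mxE; rewrite mxE.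
apply: (@cvgD R[i] R[i]^o _ (nbhs s) (nbhs_filter s)); first exact: val_SU_cvg.
exact: cvg_cst.
Qed.

Lemma dist1_continuous n : continuous (@dist1 R n).
Proof. exact: l1norm_subr_continuous. Qed.

Lemma dist1_coord_continuous k : continuous (fun x : SUprod R => dist1 (x k)).
Proof.
move=> x; apply: (@cvg_comp _ _ _ (fun x : SUprod R => x k) (@dist1 R k.+1)).
  exact: (@prod_coord_continuous nat (fun k => SU R k.+1) k).
exact: dist1_continuous.
Qed.
End NormContinuity.

(** * Elements with trivial first coordinates *)

Lemma growth_unbounded (R : realType) (v r : R) : 0 < v -> exists j, r <= (3 / 2) ^+ j * v.
Proof.
move=> v0; have [r0|r0] := leP r 0; first by exists 0%N; rewrite expr0 mul1r; lra.
have [j hj] : exists j : nat, r / v <= j%:R.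
  by exists (Num.bound (r / v)); apply/ltW/archi_boundP/divr_ge0; exact: ltW.
exists (2 * j)%N; rewrite -ler_pdivrMr//; apply: le_trans hj _.
apply: (@le_trans _ _ (2 ^+ j)); first by rewrite -natrX ler_nat ltnW// ltn_expl.
by rewrite exprM lerXn2r ?nnegrE//; lra.
Qed.

Section SubgroupElements.
Variables (G : topGroupType) (H : set G) (sH : is_subgroup H).

Lemma subgroup1 : H 1%g.
Proof. by have [/set_mem] := sH. Qed.

Lemma subgroup_div x y : H x -> H y -> H (x / y)%g.
Proof. by move=> Hx Hy; have [_ h] := sH; apply/set_mem/h; exact/mem_set. Qed.

Lemma subgroup_mul x y : H x -> H y -> H (x * y)%g.
Proof.
by move=> Hx Hy; have := subgroup_div Hx (subgroup_div subgroup1 Hy); rewrite mul1g invgK.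
Qed.

Lemma subgroup_cmt x y : H x -> H y -> H (cmt x y).
Proof. by move=> *; apply: subgroup_div; exact: subgroup_mul. Qed.

Lemma subgroup_expg x m : H x -> H (x ^+ m)%g.
Proof.
move=> Hx; elim: m => [|m IH]; first by rewrite expg0; exact: subgroup1.
by rewrite expgS; exact: subgroup_mul.
Qed.
End SubgroupElements.

Section Shrinking.
Variables (R : realType) (N : nat).
Let M := N.+2.
Let c := shrink R N.
Variables (G : set (SUprod R)) (sG : is_subgroup G) (delta : R).
Hypothesis delta0 : 0 <= delta.
(** This makes the approximants from [G] admissible in [noncentral_step]; [delta_c] makes a
    commutator with one of them multiply the earlier coordinates by at most [c ^+ 3 / 2]. *)
Hypothesis delta_q : delta <= angle R N ^+ 2.
Hypothesis delta_c : 4 * unitary_bound R N * delta <= c ^+ 3.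
Hypothesis approx : forall s : SU R N.+3, exists2 x, G x &
  l1norm (val (x M) - val s) <= delta /\ forall k, (k < M)%N -> dist1 (x k) <= delta.

(* The ratio of the earlier coordinates to the cube of the M-th one is halved by
   each commutator; it does not increase under the squarings of [doubling], which
   multiply distances to 1 by a factor between 3 / 2 and 5 / 2 <= (3 / 2) ^ 3. *)
Lemma shrinking_sequence : exists2 L, 0 <= L & forall m : nat, exists2 x, G x &
  [/\ noncentral (x M), 0 < dist1 (x M), dist1 (x M) <= 2 ^- m &
     forall k, (k < M)%N -> dist1 (x k) <= L * 2 ^- m * dist1 (x M) ^+ 3].
Proof.
have q0 := angle_gt0 R N; have qle := angle_le R N.
have [a0 a0P] := noncentral_start R N.
have [x0 Gx0 [x0a0 x0d]] := approx a0.
have [nc0 n0] := a0P _ (le_trans x0a0 delta_q).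
exists (delta / dist1 (x0 M) ^+ 3); first by rewrite divr_ge0// exprn_ge0// ltW.
elim=> [|m [x Gx [ncx x_gt0 xm xk]]].
  exists x0 => //; split => //.
    by have [h _] := nc0; rewrite expr0 invr1; lra.
  by move=> k kM; rewrite expr0 invr1 mulr1 divfK ?x0d// expf_neq0// gt_eqF.
have [b0 b0P] := noncentral_step ncx.
have [a Ga [aM ak]] := approx b0.
have [nct tge tle] := b0P _ (le_trans aM delta_q).
have cmtE k : cmt x a k = cmt (x k) (a k) by [].
have c0 : 0 < c by exact: shrink_gt0.
have half : 2 ^- m.+1 = 2 ^- m / 2 :> R by rewrite exprS invfM mulrC.
exists (cmt x a); first exact: subgroup_cmt.
rewrite cmtE; split => //.
- by apply: lt_le_trans tge; rewrite mulr_gt0.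
- by rewrite half; lra.
- move=> k kM; rewrite cmtE; apply: le_trans (dist1_cmt _ _) _.
  set L := delta / _ in xk *.
  have L0 : 0 <= L by rewrite divr_ge0// exprn_ge0// ltW.
  set v := dist1 (x M) in x_gt0 xm xk tge tle *; set v' := dist1 (cmt _ _) in tge tle *.
  have C0 : 0 <= (k.+1 ^ 2)%:R :> R by [].
  have Ck : (k.+1 ^ 2)%:R <= unitary_bound R N by rewrite unitary_boundE ler_nat leq_exp2r// ltnW.
  have h1 : (k.+1 ^ 2)%:R * dist1 (a k) <= c ^+ 3 / 4.
    apply: (@le_trans _ _ (unitary_bound R N * delta)); last by rewrite ler_pdivlMr// mulrC mulrA.
    by apply: ler_pM => //; [exact: dist1_ge0|exact: ak].
  have h2 : (c * v) ^+ 3 <= v' ^+ 3.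
    by apply: lerXn2r => //; rewrite nnegrE ?dist1_ge0// mulr_ge0// ltW.
  have h3 : 0 <= L * 2 ^- m by rewrite mulr_ge0// invr_ge0 exprn_ge0.
  (* Of the factor [c ^+ 3 / 2], the cube offsets by [h2] the loss in the M-th coordinate, and the
     half is the gain. *)
  apply: (@le_trans _ _ (2 * (c ^+ 3 / 4) * (L * 2 ^- m * v ^+ 3))).
    rewrite (_ : 2 * _ * _ * _ = 2 * ((k.+1 ^ 2)%:R * dist1 (a k)) * dist1 (x k)); last by ring.
    by apply: ler_pM; rewrite ?mulr_ge0// ?dist1_ge0// ?xk// ler_pM2l.
  rewrite half.
  have : L * 2 ^- m * (c ^+ 3 * v ^+ 3) <= L * 2 ^- m * v' ^+ 3.
    by rewrite -exprMn; exact: ler_wpM2l h3 _ _ h2.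
  move: (2 ^- m) (v ^+ 3) (v' ^+ 3) (c ^+ 3) => p a1 a2 a3; lra.
Qed.

(** Squares are taken until the M-th distance first reaches [r]; one squaring multiplies it by less
    than 3, so it cannot jump past [3 * r]. The induction is on a bound for the number of
    squarings. *)
Lemma doubling (mu r : R) : 0 <= mu <= 1 -> r <= 2^-1 ->
  forall x, G x -> 0 < dist1 (x M) -> dist1 (x M) < r ->
  (forall k, (k < M)%N -> dist1 (x k) <= mu * dist1 (x M) ^+ 3) ->
  exists2 y, G y & [/\ r <= dist1 (y M), dist1 (y M) <= 3 * r &
    forall k, (k < M)%N -> dist1 (y k) <= mu * 2].
Proof.
move=> /andP[mu0 mu1] r1 x Gx x_gt0 xr xk.
have [j hj] := growth_unbounded r x_gt0.
elim: j => [|j IH] in x Gx x_gt0 xr xk hj *.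
  by move: hj; rewrite expr0 mul1r => /le_lt_trans/(_ xr); rewrite ltxx.
have xxE k : (x * x)%g k = (x k * x k)%g by [].
have le2 := dist1_sqr_le (x M); have ge2 := dist1_sqr_ge (x M).
have Gxx : G (x * x)%g by exact: subgroup_mul.
set v := dist1 (x M) in x_gt0 xr xk hj le2 ge2 *; set w := dist1 (x M * x M)%g in le2 ge2 *.
have v2 : v ^+ 2 <= v / 2 by nra.
have wge : 3 / 2 * v <= w by lra.
have xxk k : (k < M)%N -> dist1 ((x * x)%g k) <= mu * w ^+ 3.
  move=> kM; have := xk k kM; have := dist1_sqr_le (x k); rewrite -xxE.
  have := dist1_ge0 (x k); set u := dist1 (x k) => u0 h1 h2.
  have v3 : 0 <= v ^+ 3 <= 2^-1.
    apply/andP; split; first by rewrite exprn_ge0// ltW.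
    by rewrite exprS; nra.
  have u1 : u <= 2^-1 by nra.
  apply: (@le_trans _ _ (mu * (27 / 8 * v ^+ 3))); first by nra.
  apply: ler_wpM2l => //.
  have -> : 27 / 8 * v ^+ 3 = (3 / 2 * v) ^+ 3 by field.
  by rewrite lerXn2r ?nnegrE//; lra.
have [rw|wr] := leP r w; last first.
  apply: (IH (x * x)%g) => //; rewrite xxE -/w; first by lra.
  apply: le_trans hj _; rewrite exprSr -mulrA; apply: ler_wpM2l wge.
  by apply: exprn_ge0; lra.
have w3 : w <= 3 * r by lra.
exists (x * x)%g => //; rewrite xxE -/w; split => // k kM.
apply: le_trans (xxk k kM) _; apply: ler_wpM2l => //.
(* The cube of 5 / 4 is below 2, the constant in the conclusion. *)
have w54 : w <= 5 / 4 by lra.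
have w0 : 0 <= w by lra.
apply: (@le_trans _ _ ((5 / 4) ^+ 3)); last by lra.
by rewrite lerXn2r ?nnegrE//; lra.
Qed.

Lemma almost_kernel_elements (r e : R) : 0 < r <= 2^-1 -> 0 < e ->
  exists2 y, G y & [/\ r <= dist1 (y M), dist1 (y M) <= 3 * r &
    forall k, (k < M)%N -> dist1 (y k) <= e].
Proof.
move=> /andP[r0 r1] e0; have [L L0 hL] := shrinking_sequence.
(* Once [2 ^- m] is below [t], the starting element is within [r] and [mu = L * 2 ^- m] is below 1
   and [e / 2]. The denominator [L + 1] covers the case [L = 0]. *)
pose t := Num.min (r / 2) (Num.min 1 (e / 2) / (L + 1)).
have L1 : 0 < L + 1 by lra.
have t0 : 0 < t by rewrite lt_min !divr_gt0// lt_min ltr01 divr_gt0.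
have [m _ /(_ m (leqnn _)) /=] := near_infty_natSinv_expn_lt (PosNum t0).
rewrite div1r /= lt_min (ltr_pdivlMr _ _ L1) lt_min => /andP[mr /andP[m1 me]].
have m0 : 0 <= 2 ^- m :> R by rewrite invr_ge0 exprn_ge0.
have [x Gx [_ x_gt0 xm xk]] := hL m.
have [||y Gy [y1 y2 y3]] := @doubling (L * 2 ^- m) r _ r1 x Gx x_gt0 _ xk.
- by apply/andP; split; [rewrite mulr_ge0|nra].
- by apply: le_lt_trans xm _; lra.
exists y => //; split => // k kM; apply: le_trans (y3 k kM) _; nra.
Qed.

(** A cluster point of elements of [G] whose earlier coordinates tend to 1; the two bounds on the
    M-th coordinate are closed conditions and survive. *)
Lemma kernel_elements (r : R) : compact G -> 0 < r <= 2^-1 ->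
  exists2 y, G y & [/\ forall k, (k < M)%N -> y k = 1%g,
    r <= dist1 (y M) & dist1 (y M) <= 3 * r].
Proof.
move=> cG r01.
have ex j : {y | G y /\ [/\ r <= dist1 (y M), dist1 (y M) <= 3 * r &
    forall k, (k < M)%N -> dist1 (y k) <= 2 ^- j]}.
  apply: cid; have [|y Gy hy] := @almost_kernel_elements r (2 ^- j) r01.
    by rewrite invr_gt0 exprn_gt0.
  by exists y.
pose y j := sval (ex j); have yP j := svalP (ex j).
have [|p Gp yp] := @compact_seq_cluster _ G y cG; first by move=> j; case: (yP j).
exists p => //; split.
- move=> k kM; apply: dist1_eq0; apply/eqP; rewrite eq_le dist1_ge0 andbT.
  apply: (@seq_cluster_le R _ y p (fun x : SUprod R => dist1 (x k)) _ yp).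
    exact: dist1_coord_continuous.
  move=> e e0.
  have [m _ me] := near_infty_natSinv_expn_lt (PosNum e0).
  exists m => j /me /=; rewrite div1r add0r => /ltW; apply: le_trans.
  by have [_ [_ _]] := yP j; exact.
- rewrite -lerN2; apply: (@seq_cluster_le R _ y p (fun x : SUprod R => - dist1 (x M)) _ yp).
    by apply: continuousN; exact: dist1_coord_continuous.
  by move=> e e0; exists 0%N => j _; have [_ [h _ _]] := yP j; rewrite -/(y j) in h; lra.
- apply: (@seq_cluster_le R _ y p (fun x : SUprod R => dist1 (x M)) _ yp).
    exact: dist1_coord_continuous.
  by move=> e e0; exists 0%N => j _; have [_ [_ h _]] := yP j; rewrite -/(y j) in h; lra.
Qed.
End Shrinking.

(** * Chains and connected components *)

Section Chains.
Variables (R : realType) (T : topologicalType) (d : bounded_metric R T).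
Implicit Types (L F Q B : set T) (x y : T).

Definition chain L (e : R) x y := exists k (f : nat -> T),
  [/\ f 0%N = x, f k = y, forall i, (i <= k)%N -> L (f i) &
      forall i, (i < k)%N -> d (f i) (f i.+1) < e].

Lemma chain_refl L e x : L x -> chain L e x x.
Proof. by move=> Lx; exists 0%N, (fun=> x); split. Qed.

Lemma chain_rcons L e x u v : chain L e x u -> L v -> d u v < e -> chain L e x v.
Proof.
move=> [k [f [f0 fk fL fd]]] Lv uv.
exists k.+1, (fun i => if (i <= k)%N then f i else v); split => //.
- by rewrite ltnn.
- by move=> i _; case: leqP => // /fL.
- move=> i; rewrite ltnS => ik; rewrite ik; case: ltnP => [ik'|ki]; first exact: fd.
  by rewrite (_ : i = k) ?fk//; apply/eqP; rewrite eqn_leq ik.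
Qed.

Lemma chain_le L e e' x y : e <= e' -> chain L e x y -> chain L e' x y.
Proof.
move=> ee' [k [f [f0 fk fL fd]]]; exists k, f; split => // i ik.
exact: lt_le_trans (fd i ik) ee'.
Qed.

Lemma chain_mem L e x y : chain L e x y -> L y.
Proof. by move=> [k [f [_ <- fL _]]]; exact: fL. Qed.

Lemma nbhs_bdist x e : 0 < e -> nbhs x [set y | d x y < e].
Proof. by move=> e0; apply/(bdist_nbhs d); exists e. Qed.

Lemma expn2N_lt (e : R) : 0 < e -> exists m : nat, forall j, (m <= j)%N -> 2 ^- j < e.
Proof.
move=> e0; have [m _ me] := near_infty_natSinv_expn_lt (PosNum e0).
by exists m => j /me /=; rewrite div1r.
Qed.

Lemma expn2N_gt0 m : 0 < 2 ^- m :> R.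
Proof. by rewrite invr_gt0 exprn_gt0. Qed.

Lemma cluster_closed F (y : nat -> T) p :
  closed F -> (forall j, F (y j)) -> seq_cluster y p -> F p.
Proof.
move=> cF Fy yp; apply: cF => U /yp/(_ 0%N)[j _ Uj].
by exists (y j).
Qed.

Section Component.
Variables (L : set T) (x0 : T).
Hypothesis (cL : compact L) (Lx0 : L x0).

Let Q := [set x | forall e : R, 0 < e -> chain L e x0 x].

Let Q_sub : Q `<=` L.
Proof. by move=> x /(_ 1 ltr01)/chain_mem. Qed.

Let Q_cluster (y : nat -> T) p : L p -> (forall j, chain L (2 ^- j) x0 (y j)) ->
  seq_cluster y p -> Q p.
Proof.
move=> Lp yc yp e e0; have [m me] := expn2N_lt e0.
have [j mj /= pj] := yp _ (nbhs_bdist p e0) m.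
apply: (@chain_rcons _ _ _ (y j)) => //; last by rewrite bdistC.
by apply: chain_le (yc j); apply/ltW/me.
Qed.

Let Q_compact : compact Q.
Proof.
apply: (subclosed_compact _ cL Q_sub) => p Qp e e0.
have Lp : L p.
  by apply: (compact_closed (bdist_hausdorff d) cL); apply: closure_subset Qp.
have [q [Qq /= pq]] := Qp _ (nbhs_bdist p e0).
by apply: (@chain_rcons _ _ _ q) => //; [exact: Qq|rewrite bdistC].
Qed.

(** Otherwise points of [B] come arbitrarily close to points outside [O], and a ball inside [O]
    around a cluster point in [B] would contain some of the latter. *)
Lemma compact_separation B (O : set T) : compact B -> open O -> B `<=` O ->
  exists2 e : R, 0 < e & forall b c, B b -> ~ O c -> e <= d b c.
Proof.
move=> cB oO BO; apply: contrapT => h.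
have ex j : {bc : T * T | [/\ B bc.1, ~ O bc.2 & d bc.1 bc.2 < 2 ^- j]}.
  apply: cid; apply: contrapT => h'; apply: h; exists (2 ^- j) => [|b c Bb Oc].
    exact: expn2N_gt0.
  by rewrite leNgt; apply/negP => bc; apply: h'; exists (b, c).
pose b j := (sval (ex j)).1; pose c j := (sval (ex j)).2.
have P j : [/\ B (b j), ~ O (c j) & d (b j) (c j) < 2 ^- j] := svalP (ex j).
have [|p Bp bp] := @compact_seq_cluster _ B b cB; first by move=> j; case: (P j).
have /(bdist_nbhs d)[e e0 eO] : nbhs p O by apply: open_nbhs_nbhs; split => //; exact: BO.
have e20 : 0 < e / 2 by rewrite divr_gt0.
have [m me] := expn2N_lt e20.
have [j /me mj /= pj] := bp _ (nbhs_bdist p e20) m.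
have [_ + bc] := P j; apply; apply: eO => /=.
by have := bdist_triangle d (b j) p (c j); lra.
Qed.

(** Fine chains from [x0] to a point of [Q] outside [B] must leave the [e / 2]-neighbourhood [W] of
    [B]. Their exit points cluster at some [p] in [Q] which is outside [W], hence outside [O], yet
    closer to [B] than the gap [e]. *)
Let Q_clopen B (O K : set T) : open O -> closed K -> B = Q `&` O -> B = Q `&` K ->
  B x0 -> Q `<=` B.
Proof.
move=> oO cK BO BK Bx0; apply: contrapT => /existsNP[c /not_implyP[Qc Bc]].
have cB : compact B by rewrite BK; exact: compact_closedI.
have subBO : B `<=` O by rewrite BO => x [].
have [e e0 eB] := compact_separation cB oO subBO.
pose W := [set x | exists2 b, B b & d b x < e / 2].
have e2 : 0 < e / 2 by rewrite divr_gt0.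
have Wc : ~ W c.
  move=> [b Bb bc]; have : ~ O c by move=> Oc; apply: Bc; rewrite BO.
  by move=> /(eB b c Bb); lra.
have ex j : {v | [/\ chain L (2 ^- j) x0 v, ~ W v &
    exists2 b, B b & d b v < e / 2 + 2 ^- j]}.
  apply: cid; have [k [f [f0 fk fL fd]]] := Qc _ (expn2N_gt0 j).
  (* The chain is cut at its first point outside [W]; the predecessor lies in [W], so this point is
     at most one step beyond distance [e / 2] from [B]. *)
  have exk : exists i, `[< ~ W (f i) >] by exists k; apply/asboolP; rewrite fk.
  case: (ex_minnP exk) => i /asboolP Wi imin.
  have ik : (i <= k)%N by apply: imin; apply/asboolP; rewrite fk.
  case: i => [|i] in Wi imin ik *.
    by exfalso; apply: Wi; rewrite f0; exists x0 => //; rewrite bdistxx.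
  have [b Bb bi] : W (f i).
    apply: contrapT => Wfi; suff : (i.+1 <= i)%N by rewrite ltnn.
    by apply: imin; exact/asboolP.
  exists (f i.+1); split => //.
    exists i.+1, f; split => // m mi; first by apply: fL; exact: leq_trans ik.
    by apply: fd; exact: leq_trans ik.
  by exists b => //; exact: le_lt_trans (bdist_triangle d (f i) _ _) (ltrD bi (fd i ik)).
pose v j := sval (ex j).
have P j : [/\ chain L (2 ^- j) x0 (v j), ~ W (v j) &
    exists2 b, B b & d b (v j) < e / 2 + 2 ^- j] := svalP (ex j).
have [|p Lp vp] := @compact_seq_cluster _ L v cL.
  by move=> j; have [/chain_mem] := P j.
have Qp : Q p by apply: (Q_cluster Lp _ vp) => j; case: (P j).
have Wp : ~ W p.
  move=> [b Bb bp]; have r0 : 0 < e / 2 - d b p by rewrite subr_gt0.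
  have [j _ /= pj] := vp _ (nbhs_bdist p r0) 0%N.
  have [_ + _] := P j; apply; exists b => //.
  by have := bdist_triangle d p b (v j); lra.
have Op : ~ O p.
  move=> Op; apply: Wp; exists p; last by rewrite bdistxx.
  by rewrite BO.
have e4 : 0 < e / 4 by rewrite divr_gt0.
have [m me] := expn2N_lt e4.
have [j /me mj /= pj] := vp _ (nbhs_bdist p e4) m.
have [_ _ [b Bb bv]] := P j.
have h : d b (v j) < e / 2 + e / 4 by apply: lt_trans bv _; rewrite ltrD2l.
by have := eB _ _ Bb Op; have := bdist_triangle d (v j) b p; rewrite (bdistC d (v j)); lra.
Qed.

Let Q_connected : connected Q.
Proof.
move=> B [b Bb] [U oU BU] [K cK BK]; apply/seteqP; split.
  by move=> x; rewrite BU; case.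
have Qx0 : Q x0 by move=> e _; exact: chain_refl.
have [Bx0|Bx0] := pselect (B x0); first exact: Q_clopen BU BK Bx0.
exfalso.
(* If [B] misses [x0], its complement in [Q] is clopen and contains [x0], so it is all of [Q],
   against [B b]. *)
have QB : Q `\` B = Q `&` ~` U by rewrite BU setDIr setDv set0U setDE.
have QB' : Q `\` B = Q `&` ~` K by rewrite BK setDIr setDv set0U setDE.
have Qb : Q b by move: Bb; rewrite BU => -[].
suff : (Q `\` B) b by case.
by apply: (Q_clopen (closed_openC cK) (open_closedC oU) QB' QB _ Qb); split.
Qed.

(* The points reachable from x0 by chains of arbitrarily small step form a
   connected set. *)
Lemma chain_component F : closed F ->
  (forall e : R, 0 < e -> exists2 y, F y & chain L e x0 y) ->
  exists2 y, connected_component L x0 y & F y.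
Proof.
move=> cF h.
have ex j : {y | F y /\ chain L (2 ^- j) x0 y}.
  by apply: cid; have [y Fy yc] := h _ (expn2N_gt0 j); exists y.
pose y j := sval (ex j); have yP j : F (y j) /\ chain L (2 ^- j) x0 (y j) := svalP (ex j).
have [|p Lp yp] := @compact_seq_cluster _ L y cL.
  by move=> j; have [_ /chain_mem] := yP j.
have Qp : Q p by apply: (Q_cluster Lp _ yp) => j; case: (yP j).
exists p; last by apply: (cluster_closed cF _ yp) => j; case: (yP j).
apply: (@connected_component_max _ L Q) => //.
by move=> e _; exact: chain_refl.
Qed.
End Component.
End Chains.

(** * Small connected subgroups *)

Lemma coord_expg (I : Type) (T : I -> topGroupType) (x : prod_topology T) i m :
  (x ^+ m)%g i = (x i ^+ m)%g.
Proof. by elim: m => [|m IH]; rewrite ?expg0// !expgS -IH. Qed.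

(** As long as the powers stay within 1 / 2 of the identity, each squaring multiplies the distance
    by at least 3 / 2. *)
Lemma dist1_escape (R : realType) n (s : SU R n) : s <> 1%g ->
  exists m, 2^-1 <= dist1 (s ^+ m)%g.
Proof.
move=> s1; apply: contrapT => h.
have small m : dist1 (s ^+ m)%g < 2^-1 by rewrite ltNge; apply/negP => hm; apply: h; exists m.
have s0 : 0 < dist1 s by rewrite lt_neqAle dist1_ge0 andbT eq_sym; apply/eqP => /dist1_eq0.
have grow m : (3 / 2) ^+ m * dist1 s <= dist1 (s ^+ (2 ^ m))%g.
  elim: m => [|m IH]; first by rewrite expr0 mul1r expn0 expg1.
  rewrite expnS mul2n -addnn expgnDr exprS -mulrA.
  have := dist1_sqr_ge (s ^+ (2 ^ m))%g; have := small (2 ^ m)%N.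
  have := dist1_ge0 (s ^+ (2 ^ m))%g; nra.
have [m hm] := growth_unbounded (2^-1) s0.
by have := small (2 ^ m)%N; have := grow m; lra.
Qed.

Section ProductInvariance.
Variables (R : realType) (T : nat -> topGroupType).
Variable d : forall k, biinvariant_metric R (T k).
Let D := prod_metric (fun k => bimetric (d k)).

Lemma prod_metricMl (g x y : prod_topology T) : D (g * x)%g (g * y)%g = D x y.
Proof.
rewrite /D /= /prod_dist; congr (limn (series _)); apply/funext => k.
by congr (_ * _); exact: bimetricMl.
Qed.

Lemma prod_metricMr (g x y : prod_topology T) : D (x * g)%g (y * g)%g = D x y.
Proof.
rewrite /D /= /prod_dist; congr (limn (series _)); apply/funext => k.
by congr (_ * _); exact: bimetricMr.
Qed.
End ProductInvariance.

Section SmallConnectedSubgroup.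
Variables (R : realType) (d : forall k, biinvariant_metric R (SU R k.+1)) (N : nat).
Let D : bounded_metric R (SUprod R) := prod_metric (fun k => bimetric (d k)).
Let M := N.+2.

Definition tail_subgroup (m : nat) : set (SUprod R) := [set x | forall k, (k < m)%N -> x k = 1%g].

Lemma tail_subgroup_closed m : closed (tail_subgroup m).
Proof.
have -> : tail_subgroup m =
    \bigcap_(k in [set k | (k < m)%N]) [set x : SUprod R | dist1 (x k) <= 0].
  apply/seteqP; split=> x xm k /= km; first by rewrite xm ?dist1_1.
  by apply: dist1_eq0; apply/eqP; rewrite eq_le dist1_ge0 andbT; exact: xm.
apply: closed_bigI => k _.
apply: (@closed_comp _ _ (fun x : SUprod R => dist1 (x k)) [set y | y <= 0]).
  by move=> x _; exact: dist1_coord_continuous.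
exact: closed_le.
Qed.

Lemma tail_subgroup_is_subgroup m : is_subgroup (tail_subgroup m).
Proof.
split; first by rewrite inE.
move=> x y /set_mem xm /set_mem ym; apply/mem_set => k km.
have -> : (x / y)%g k = (x k / y k)%g by [].
by rewrite xm// ym// mulgV.
Qed.

Lemma is_subgroupI (H : topGroupType) (A B : set H) :
  is_subgroup A -> is_subgroup B -> is_subgroup (A `&` B).
Proof.
move=> sA sB; split; first by apply/mem_set; split; exact: subgroup1.
by move=> x y /set_mem[Ax Bx] /set_mem[Ay By]; apply/mem_set; split; exact: subgroup_div.
Qed.

Variables (G : compact_subgroup (SUprod R)) (delta : R).
Hypothesis delta0 : 0 <= delta.
Hypothesis delta_q : delta <= angle R N ^+ 2.
Hypothesis delta_c : 4 * unitary_bound R N * delta <= shrink R N ^+ 3.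
Hypothesis approx : forall s : SU R N.+3, exists2 x, (G : set _) x &
  l1norm (val (x M) - val s) <= delta /\ forall k, (k < M)%N -> dist1 (x k) <= delta.

Let L := (G : set (SUprod R)) `&` tail_subgroup M.

Let sL : is_subgroup L.
Proof. by apply: is_subgroupI; [exact: csubgroupP|exact: tail_subgroup_is_subgroup]. Qed.

Let cL : compact L.
Proof. by apply: compact_closedI; [exact: csubgroup_compact|exact: tail_subgroup_closed]. Qed.

(** The elements from [kernel_elements] are controlled only up to coordinate [M] and need not
    approach 1. If their M-th coordinates tend to 1 without reaching it, a cluster point [p] has
    trivial M-th coordinate, and dividing by [p] brings them close to 1 without changing that
    coordinate. *)
Let small_element e : 0 < e -> exists2 z, L z & D 1%g z < e /\ z M <> 1%g.
Proof.
move=> e0.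
have ex j : {y | L y /\ [/\ 2 ^- j.+1 <= dist1 (y M) & dist1 (y M) <= 3 * 2 ^- j.+1]}.
  apply: cid.
  have [|y Gy [y1 y2 y3]] := kernel_elements (csubgroupP G) delta0 delta_q delta_c approx
      (r := 2 ^- j.+1) (@csubgroup_compact _ G).
    rewrite expn2N_gt0/= exprS invfM ler_piMr ?invr_ge0//.
    by rewrite invf_le1 ?exprn_gt0// exprn_ege1// ler1n.
  by exists y; split.
pose y j := sval (ex j).
have yP j : L (y j) /\ [/\ 2 ^- j.+1 <= dist1 (y j M) & dist1 (y j M) <= 3 * 2 ^- j.+1] :=
  svalP (ex j).
have [|p Lp yp] := @compact_seq_cluster _ L y cL; first by move=> j; case: (yP j).
have pM : p M = 1%g.
  apply: dist1_eq0; apply/eqP; rewrite eq_le dist1_ge0 andbT.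
  apply: (@seq_cluster_le R _ y p (fun x : SUprod R => dist1 (x M)) _ yp).
    exact: dist1_coord_continuous.
  move=> a a0; have a3 : 0 < a / 3 by rewrite divr_gt0.
  have [m me] := expn2N_lt a3; exists m => j mj; rewrite add0r.
  have [_ [_ h]] := yP j; have := me j.+1 (leqW mj); lra.
have [j _ /= pj] := yp _ (nbhs_bdist D p e0) 0%N.
have [Ly [y1 _]] := yP j.
exists (y j / p)%g; first exact: subgroup_div.
split.
  have DE : D 1%g (y j / p)%g = D p (y j).
    by rewrite -(mulgV p); exact: (prod_metricMr d).
  exact: (eq_ind_r (fun t => t < e) pj DE).
have -> : (y j / p)%g M = (y j M / p M)%g by [].
rewrite pM invg1 mulg1 => yM; move: y1; rewrite yM dist1_1.
by rewrite leNgt expn2N_gt0.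
Qed.

Lemma small_connected_subgroup : exists K : set (SUprod R),
  [/\ is_subgroup K, K `<=` identity_component (G : set (SUprod R)),
      K `<=` tail_subgroup M & exists2 y, K y & y <> 1%g].
Proof.
exists (identity_component L); split.
- exact: identity_component_subgroup.
- move=> x Lx; apply: (@connected_component_max _ (G : set _) (identity_component L)) => //.
  + by have /set_mem := (identity_component_subgroup sL).1.
  + by move=> y /connected_component_sub[].
  + exact: component_connected.
- by move=> x /connected_component_sub[].
have [||y Ly yF] := @chain_component _ _ D L 1%g cL (subgroup1 sL) [set x | 2^-1 <= dist1 (x M)].
- apply: (@closed_comp _ _ (fun x : SUprod R => dist1 (x M)) [set y | 2^-1 <= y]).
    by move=> x _; exact: dist1_coord_continuous.
  exact: closed_ge.
- move=> e /small_element[z Lz [z_e zM]].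
  have [m zm] := dist1_escape zM.
  exists (z ^+ m)%g; first by rewrite /= coord_expg.
  exists m, (fun i => z ^+ i)%g; split => //.
    by move=> i _; exact: subgroup_expg.
  (* By left invariance all steps of the chain of powers have the same length. *)
  move=> i _; have DE : D (z ^+ i)%g (z ^+ i.+1)%g = D 1%g z.
    by rewrite expgSr -[X in D X _]mulg1; exact: (prod_metricMl d).
  exact: (eq_ind_r (fun t => t < e) z_e DE).
exists y => //; move=> y1; move: yF; rewrite /= y1 dist1_1.
by rewrite leNgt invr_gt0 ltr0n.
Qed.
End SmallConnectedSubgroup.

(** * Growth of the squaring map in a chart *)

Section DiagonalGrowth.
Variables (R : realType) (m : nat).
Local Notation V := 'rV[R]_m.

Lemma pair_scaleD (h : R) (a b x y : V) :
  h *: ((a, b) : V * V) + (x, y) = (h *: a + x, h *: b + y).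
Proof. by []. Qed.

Lemma rV_norm_le (x : V) (e : R) : 0 <= e -> (forall j, `|x 0 j| <= e) -> `|x| <= e.
Proof.
move=> e0 xe; rewrite [leLHS]/Num.Def.normr/= mx_normrE.
by apply: bigmax_le => // -[i j] _; rewrite (ord1 i); exact: xe.
Qed.

Lemma rV_norm_ge (x : V) j : `|x 0 j| <= `|x|.
Proof.
rewrite [leRHS]/Num.Def.normr/= mx_normrE.
exact: (le_bigmax _ (fun ij : 'I_1 * 'I_m => `|x ij.1 ij.2|) (0, j)).
Qed.

Lemma MVT_signed (g dg : R -> R) (t : R) :
  (forall s : R, `|s| <= `|t| -> is_derive s (1 : R) g (dg s)) ->
  exists2 s : R, `|s| <= `|t| & g t - g 0 = dg s * t.
Proof.
move=> gd.
have gc a b : (forall s, s \in `[a, b]%R -> `|s| <= `|t|) -> {within `[a, b], continuous g}.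
  move=> ab; apply: continuous_in_subspaceT => s; rewrite inE => /ab/gd sd.
  by apply: differentiable_continuous; apply/derivable1_diffP.
have [t0|t0] := leP 0 t.
  have tt s : s \in `[0, t]%R -> `|s| <= `|t|.
    by rewrite in_itv/= => /andP[s0 st]; rewrite !ger0_norm.
  have [||s st e] := @MVT_segment R g dg 0 t t0.
  - by move=> s st; apply/gd/tt; apply: subset_itv_oo_cc.
  - exact: gc.
  - by exists s; [exact: tt|rewrite e subr0].
have tt s : s \in `[t, 0]%R -> `|s| <= `|t|.
  by rewrite in_itv/= => /andP[s0 st]; rewrite !ler0_norm ?(ltW t0) ?lerN2.
have [||s st e] := @MVT_segment R g dg t 0 (ltW t0).
- by move=> s st; apply/gd/tt; apply: subset_itv_oo_cc.
- exact: gc.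
- by exists s; [exact: tt|rewrite -opprB e; ring].
Qed.

(** [f] stands for the group multiplication read in a chart and [p0] for the coordinates of 1;
    [f_right] and [f_left] are then the unit laws. *)
Variables (D : set (V * V)%type) (f : V * V -> V) (p0 : V).
Hypothesis Dnbhs : nbhs (p0, p0) D.
Hypothesis fC1 : classC 1 D f.
Hypothesis f_right : \forall w \near p0, f (p0, w) = w.
Hypothesis f_left : \forall u \near p0, f (u, p0) = u.

Let e_ (i : 'I_m) : V := delta_mx 0 i.
Let v_ (i : 'I_m) : V * V := (0, e_ i).

Let derivable_f i x : D x -> derivable f x (v_ i).
Proof. by have [_ /(_ (v_ i))[h _]] := fC1; exact: h. Qed.

Let derive_f_continuous i : {for (p0, p0), continuous ('D_(v_ i) f)}.
Proof.
have [_ /(_ (v_ i))[_ [h _]]] := fC1; apply: h; rewrite inE.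
exact: nbhs_singleton.
Qed.

Let derive_f_center i : 'D_(v_ i) f (p0, p0) = e_ i.
Proof.
apply: cvg_lim => //.
have f0 : f (p0, p0) = p0 by exact: (nbhs_singleton f_right).
apply: cvg_near_cst.
have h0 : (fun h : R => h *: e_ i + p0) @ 0^' --> p0.
  rewrite -[X in _ --> X](add0r p0) -(scale0r (e_ i)).
  apply: cvgD; last exact: cvg_cst.
  apply: cvgZl; exact: nbhs_dnbhs.
have fr : \forall h \near (0 : R)^', f (p0, h *: e_ i + p0) = h *: e_ i + p0 := h0 _ f_right.
near=> h => /=.
rewrite f0 (_ : h *: v_ i + (p0, p0) = (p0, h *: e_ i + p0)).
  rewrite (near fr h)//.
  rewrite addrK scalerA mulVf ?scale1r//; near: h; exact: nbhs_dnbhs_neq.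
by rewrite /v_ pair_scaleD scaler0 add0r.
Unshelve. all: by end_near. Qed.

Let coord_is_derive u w i j s : D (u, w + s *: e_ i) ->
  is_derive s (1 : R) (fun s : R => f (u, w + s *: e_ i) 0 j)
    ('D_(v_ i) f (u, w + s *: e_ i) 0 j).
Proof.
move=> Dx; have fd := @derivable_f i _ Dx.
have Fd := (derivable_mxP _ _ _).1 fd 0 j.
have E : (fun h : R => h^-1 *: (f (u, w + (h *: 1 + s) *: e_ i) 0 j - f (u, w + s *: e_ i) 0 j))
  = (fun h : R => h^-1 *: (f (h *: v_ i + (u, w + s *: e_ i)) 0 j - f (u, w + s *: e_ i) 0 j)).
  apply/funext => h; congr (_ *: (f _ 0 j - _)).
  rewrite /v_ pair_scaleD scaler0 add0r; congr (_, _).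
  by rewrite scalerDl [h *: 1]mulr1 addrCA.
apply: DeriveDef.
  by rewrite /derivable /= E; exact: Fd.
rewrite derive_mx// mxE /derive /= E //.
Qed.

(* The second argument moves from p0 to u one coordinate at a time, so that the
   mean value theorem only involves the partial derivatives along the [v_ i],
   which are close to their values at (p0, p0). *)
Lemma diagonal_growth : exists2 r, 0 < r & forall u, `|u - p0| < r ->
  `|f (u, u) - u - (u - p0)| <= `|u - p0| / 2.
Proof.
(* Each of the [m] coordinate moves costs at most [eta * n], for a total of at most [n / 2]; [m.+1]
   also covers dimension zero. *)
pose eta : R := (2 * m.+1%:R)^-1.
have eta0 : 0 < eta by rewrite invr_gt0 mulr_gt0.
have : \forall x \near (p0, p0), D x /\ forall i, `|'D_(v_ i) f x - e_ i| < eta.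
  near=> x; split; first by near: x; exact: Dnbhs.
  near: x; apply: filter_forall => i.
  have /cvgrPdist_lt/(_ _ eta0) := @derive_f_continuous i.
  by apply: filterS => x; rewrite derive_f_center distrC.
move=> /nbhs_ballP[r /= r0 hr].
have [r' /= r'0 hr'] := (nbhs_ballP _ _).1 f_left.
exists (Num.min r r'); first by rewrite /= lt_min r0.
move=> u; rewrite lt_min => /andP[ur ur'].
have fu : f (u, p0) = u by apply: hr'; rewrite -ball_normE /= distrC.
pose W k : V := \row_i (if (i < k)%N then u 0 i else p0 0 i).
have W0 : W 0%N = p0 by apply/rowP => i; rewrite mxE ltn0.
have Wm : W m = u by apply/rowP => i; rewrite mxE ltn_ord.
set n := `|u - p0| in ur ur' *.
have stepb (k : 'I_m) j : `|(f (u, W k.+1) - f (u, W k) - (W k.+1 - W k)) 0 j| <= eta * n.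
  pose t := (u - p0) 0 k.
  have tn : `|t| <= n by exact: rV_norm_ge.
  have WS : W k.+1 = W k + t *: e_ k.
    apply/rowP => i; rewrite /t /e_ !mxE/= ltnS leq_eqVlt.
    have [->|ik] := eqVneq i k; first by rewrite eqxx ltnn/=; ring.
    by rewrite (negPf (_ : (i : nat) != k))//= mulr0 addr0.
  have Ws s : `|s| <= `|t| ->
      D (u, W k + s *: e_ k) /\ forall i, `|'D_(v_ i) f (u, W k + s *: e_ k) - e_ i| < eta.
    move=> st; apply: hr; split => /=; rewrite -ball_normE /= distrC//.
    apply: le_lt_trans ur; apply: rV_norm_le => [|i]; first exact: normr_ge0.
    rewrite /e_ !mxE/=; have [->|ik] := eqVneq i k.
      by rewrite ltnn ?eqxx mulr1 addrAC subrr add0r (le_trans st).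
    rewrite mulr0 addr0; case: ifP => _; last by rewrite subrr normr0 normr_ge0.
    by have := rV_norm_ge (u - p0) i; rewrite !mxE.
  have [s st] := @MVT_signed (fun s => f (u, W k + s *: e_ k) 0 j)
    (fun s => 'D_(v_ k) f (u, W k + s *: e_ k) 0 j) t
    (fun s st => coord_is_derive j (Ws s st).1).
  rewrite -WS scale0r addr0 => E.
  have -> : (f (u, W k.+1) - f (u, W k) - (W k.+1 - W k)) 0 j =
      ('D_(v_ k) f (u, W k + s *: e_ k) - e_ k) 0 j * t.
    rewrite {2}WS; move: E; rewrite ![((_ - _) : V) 0 j]mxE => E.
    rewrite mulrDl -E !mxE; ring.
  rewrite normrM; apply: ler_pM => //.
  apply: le_trans (rV_norm_ge _ _) _; apply: ltW.
  exact: (Ws s st).2.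
have total k : (k <= m)%N -> forall j,
    `|(f (u, W k) - f (u, p0) - (W k - p0)) 0 j| <= k%:R * (eta * n).
  elim: k => [_ j|k IH km j]; first by rewrite W0 !subrr mxE normr0 mul0r.
  have := stepb (Ordinal km) j; have := IH (ltnW km) j.
  set a := f (u, W k) - _ - _; set b := f (u, W _) - _ - _ => ha hb.
  rewrite (_ : f (u, W k.+1) - f (u, p0) - (W k.+1 - p0) = a + b).
    rewrite mxE; apply: le_trans (ler_normD _ _) _.
    by rewrite -natr1 mulrDl mul1r lerD.
  by rewrite /a /b; apply/rowP => i; rewrite !mxE/=; ring.
have n0 : 0 <= n by exact: normr_ge0.
apply: rV_norm_le => [|j]; first by rewrite divr_ge0.
have := total m (leqnn m) j; rewrite Wm fu => h; apply: le_trans h _.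
rewrite mulrA; rewrite mulrC; apply: ler_wpM2l => //.
rewrite /eta invfM mulrCA ler_piMr// ler_pdivrMr// mul1r ler_nat.
exact: leqnSn.
Unshelve. all: by end_near. Qed.
End DiagonalGrowth.

Lemma lie_group_no_small_subgroup (R : realType) (G : topGroupType) : is_lie_group R G ->
  exists2 W : set G, nbhs 1%g W & forall x, (forall j, W (x ^+ (2 ^ j))%g) -> x = 1%g.
Proof.
move=> [_ _ [m [A [[cover _] smul _]]]].
have [c Ac c1] := cover 1%g.
have := smul c c c Ac Ac Ac 1%N.
set D := (X in classC _ X); set f := (X in classC _ _ X) => fC1.
set U := chart_dom c in c1; pose psi := chart_inv c; pose p0 := c 1%g.
have oU : open U := @chart_dom_open _ _ _ c.
have oV : open (c @` U) := @chart_cod_open _ _ _ c.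
have cK x : U x -> psi (c x) = x by move=> Ux; apply: chart_mapK; rewrite inE.
have Vp0 : (c @` U) p0 by exists 1%g.
have Vnear : \forall u \near p0, (c @` U) u by apply: open_nbhs_nbhs; split.
have psi_p0 : psi p0 = 1%g by exact: cK.
have psi_cont : {for p0, continuous psi}.
  have := @chart_inv_continuous _ _ _ c; rewrite -/U continuous_open_subspace//.
  by apply; rewrite inE.
have c_cont : {for (1%g : G), continuous c}.
  have := @chart_map_continuous _ _ _ c; rewrite -/U continuous_open_subspace//.
  by apply; rewrite inE.
have Dnbhs : nbhs (p0, p0) D.
  have mulU : \forall x \near (p0, p0), U (psi x.1 * psi x.2)%g.
    have : (fun x => psi x.1 * psi x.2)%g @ (p0, p0) --> (1 * 1 : G)%g.
      apply: mulg_cvg; rewrite -psi_p0.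
        by apply: (@cvg_comp _ _ _ fst psi); [exact: cvg_fst|exact: psi_cont].
      by apply: (@cvg_comp _ _ _ snd psi); [exact: cvg_snd|exact: psi_cont].
    by apply; rewrite mulg1; apply: open_nbhs_nbhs.
  have V1 : \forall x \near (p0, p0), (c @` U) x.1 by exact: (@cvg_fst _ _ (nbhs p0) (nbhs p0)).
  have V2 : \forall x \near (p0, p0), (c @` U) x.2 by exact: (@cvg_snd _ _ (nbhs p0) (nbhs p0)).
  near=> x.
  have [a Ua ax] : (c @` U) x.1 by near: x.
  have [b Ub bx] : (c @` U) x.2 by near: x.
  exists (a, b); last by rewrite /= ax bx -surjective_pairing.
  split => //=; rewrite -(cK a Ua) -(cK b Ub) ax bx.
  by near: x.
have f_right : \forall w \near p0, f (p0, w) = w.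
  apply: filterS Vnear => _ [x Ux <-].
  by rewrite /f /= -/psi psi_p0 mul1g cK.
have f_left : \forall u \near p0, f (u, p0) = u.
  apply: filterS Vnear => _ [x Ux <-].
  by rewrite /f /= -/psi psi_p0 mulg1 cK.
have [r r0 growth] := diagonal_growth Dnbhs fC1 f_right f_left.
exists (U `&` [set x | `|c x - p0| < r]).
  apply: filterI; first by apply: open_nbhs_nbhs.
  by have /cvgrPdist_lt/(_ _ r0) := c_cont; apply: filterS => x; rewrite distrC.
move=> x xW; pose n j := `|c (x ^+ (2 ^ j))%g - p0|.
have nS j : 3 / 2 * n j <= n j.+1.
  have [Uj rj] := xW j; have := growth _ rj.
  rewrite /f /= -/psi cK// -expgnDr addnn -mul2n -expnS /n.
  set a := c (x ^+ (2 ^ j))%g; set b := c (x ^+ (2 ^ j.+1))%g => h.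
  (* The last bracket is the error bounded by [diagonal_growth] by half of the norm of [a - p0],
     leaving a growth factor of 3 / 2. *)
  have e : (a - p0) + (a - p0) = (b - p0) - (b - a - (a - p0)).
    by apply/rowP => i; rewrite !mxE; ring.
  have h1 : `|(a - p0) + (a - p0)| = 2 * `|a - p0|.
    by rewrite -mulr2n normrMn mulr_natl.
  have := ler_normB (b - p0) (b - a - (a - p0)); rewrite -e h1; lra.
have nj j : (3 / 2) ^+ j * n 0%N <= n j.
  elim: j => [|j IH]; first by rewrite expr0 mul1r.
  by rewrite exprS -mulrA; apply: le_trans (nS j); rewrite ler_pM2l.
have n0 : n 0%N = 0.
  apply/eqP; rewrite eq_le normr_ge0 andbT leNgt; apply/negP => n0.
  have [j hj] := growth_unbounded r n0.
  by have := nj j; have [_ /=] := xW j; rewrite -/(n j); lra.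
have [Ux _] := xW 0%N; rewrite expn0 expg1 in Ux.
move/eqP: n0; rewrite /n expn0 expg1 normr_eq0 subr_eq0 => /eqP cx.
by rewrite -(cK x Ux) cx psi_p0.
Unshelve. all: by end_near. Qed.

(** * Compactness of SU(n) *)

Section SpecialUnitaryCompact.
Variables (R : realType) (n : nat).
Local Open Scope sesquilinear_scope.
Local Notation C := R[i].

Lemma complex_cvg (T : Type) (F : set_system T) (FF : Filter F) (f : T -> C) (z : C) :
  (forall e : R, 0 < e -> \forall t \near F, normc (z - f t) < e) -> f @ F --> z.
Proof.
move=> h; apply/(@cvgrPdist_lt C C^o T F FF f z) => e e0.
have /complex_realP[e' ee] : (e : C) \is Num.real by exact: gtr0_real.
have e'0 : 0 < e' by move: e0; rewrite ee ltcR.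
by apply: filterS (h e' e'0) => t; rewrite normc_norm ee ltcR.
Qed.

Lemma normc_ReIm_le (a b : R) : normc (a +i* b)%C <= `|a| + `|b|.
Proof.
have -> : (a +i* b)%C = a%:C%C + 'i%C * b%:C%C by simpc.
apply: le_trans (le_normcD _ _) _; rewrite normcM !normc_real lerD2l.
by rewrite (_ : normc 'i%C = 1) ?mul1r//= expr0n expr1n add0r sqrtr1.
Qed.

Lemma complex_of_pair_continuous : continuous (fun p : R * R => (p.1 +i* p.2)%C : C).
Proof.
move=> [a b]; apply: (complex_cvg (nbhs_filter _)) => e e0.
have e2 : 0 < e / 2 by rewrite divr_gt0.
near=> p; apply: le_lt_trans (normc_ReIm_le (a - p.1) (b - p.2)) _.
rewrite [e]splitr; apply: ltrD; near: p.
- have /cvgrPdist_lt/(_ _ e2) : (fun p : R * R => p.1) @ (a, b) --> a by exact: cvg_fst.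
  exact.
- have /cvgrPdist_lt/(_ _ e2) : (fun p : R * R => p.2) @ (a, b) --> b by exact: cvg_snd.
  exact.
Unshelve. all: by end_near. Qed.

(** A compact set containing the closed unit disc, where the entries of unitary matrices lie. *)
Definition square : set C := (fun p : R * R => (p.1 +i* p.2)%C) @` (`[-1, 1] `*` `[-1, 1]).

Lemma square_compact : compact square.
Proof.
apply: continuous_compact.
  exact/continuous_subspaceT/complex_of_pair_continuous.
by apply: compact_setX; exact: segment_compact.
Qed.

Lemma square_normc z : normc z <= 1 -> square z.
Proof.
case: z => a b zab; exists (a, b) => //; split => /=; rewrite in_itv/= -ler_norml;
  apply: le_trans zab; rewrite -sqrtr_sqr ler_sqrt ?addr_ge0 ?sqr_ge0//.
- by rewrite lerDl sqr_ge0.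
- by rewrite lerDr sqr_ge0.
Qed.

Lemma matrix_cvg (T : Type) (F : set_system T) (FF : Filter F) (f : T -> 'M[C]_n) (A : 'M[C]_n) :
  (forall i j, (fun t => f t i j) @ F --> A i j) -> f @ F --> A.
Proof.
move=> fA B [P PA PB]; rewrite nbhs_filterE; apply: filterS PB _.
by apply: filter_forall => i; apply: filter_forall => j; exact: (fA i j _ (PA i j)).
Qed.

Let box := [set v : 'rV[C]_(n * n) | forall i, square (v 0 i)].

Lemma special_unitary_box : @special_unitary R n `<=` vec_mx @` box.
Proof.
move=> A [Au _]; exists (mxvec A); last exact: mxvecK.
move=> k; case/mxvec_indexP: k => i j; rewrite mxvecE.
exact/square_normc/normc_unitary.
Qed.

Lemma box_compact : compact (vec_mx @` box : set 'M[C]_n).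
Proof.
apply: continuous_compact; last first.
  exact: (@rV_compact C^o (n * n) (fun=> square) (fun=> square_compact)).
apply: continuous_subspaceT => v; apply: (matrix_cvg (nbhs_filter v)) => i j.
under eq_fun do rewrite mxE; rewrite mxE.
exact: (@coord_continuous C 1 (n * n) 0 (mxvec_index i j)).
Qed.

Lemma conjC_cvg (T : Type) (F : set_system T) (FF : Filter F) (f : T -> C) z :
  f @ F --> z -> (fun t => Num.conj (f t)) @ F --> Num.conj z.
Proof.
move=> fz; apply: (complex_cvg FF) => e e0.
have e0' : 0 < e%:C%C :> C by rewrite ltcR.
apply: filterS ((@cvgrPdist_lt C C^o T F FF f z).1 fz _ e0') => t.
by rewrite -norm_conjC rmorphB/= normc_norm ltcR.
Qed.

Lemma closed_eq_matrix (g : 'M[C]_n -> C) z :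
  (forall A : 'M[C]_n, g @ A --> g A) -> closed [set A | g A = z].
Proof.
move=> gc.
have -> : [set A | g A = z] = [set A | normc (g A - z) <= 0].
  apply/seteqP; split=> A /=; first by move=> ->; rewrite subrr normc0.
  move=> h; apply/eqP; rewrite -subr_eq0; apply/eqP/eq0_normc/eqP.
  by rewrite eq_le h normc_ge0.
apply: (@closed_comp _ _ (fun A => normc (g A - z)) [set y | y <= 0]); last exact: closed_le.
move=> A _; apply: (normc_cvg (nbhs_filter A)).
apply: (@cvgD C C^o _ (nbhs A) (nbhs_filter A)); [exact: gc|exact: cvg_cst].
Qed.

Lemma matrix_entry_cvg (A : 'M[C]_n) i j : (fun B : 'M[C]_n => B i j) @ A --> A i j.
Proof. exact: (@coord_continuous C n n i j). Qed.

Lemma special_unitary_closed : closed (@special_unitary R n).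
Proof.
have -> : @special_unitary R n =
    (\bigcap_(ij in [set: 'I_n * 'I_n])
      [set A : 'M[C]_n | (A *m A^t*) ij.1 ij.2 = (ij.1 == ij.2)%:R]) `&`
    [set A | \det A = 1].
  apply/seteqP; split=> A [hA dA]; split => //.
    by move=> [i j] _ /=; move/unitarymxP: hA => ->; rewrite mxE.
  by apply/unitarymxP/matrixP => i j; rewrite (hA (i, j))// mxE.
apply: closedI.
  apply: closed_bigI => -[i j] _ /=; apply: closed_eq_matrix => A.
  rewrite mxE; under eq_fun do rewrite mxE.
  apply: (@cvg_big C _ +%R 0 xpredT (@add_continuous C^o) _ _ _ _ _ (nbhs_filter A)) => k _.
  apply: (@cvgM C _ (nbhs A) (nbhs_filter A)); first exact: matrix_entry_cvg.
  rewrite 2!mxE; under eq_fun do rewrite 2!mxE.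
  apply: (conjC_cvg (nbhs_filter A)); exact: matrix_entry_cvg.
apply: closed_eq_matrix => A; rewrite /determinant.
apply: (@cvg_big C _ +%R 0 xpredT (@add_continuous C^o) _ _ _ _ _ (nbhs_filter A)) => s _.
apply: (@cvgM C _ (nbhs A) (nbhs_filter A)); first exact: cvg_cst.
apply: (@cvg_big C _ *%R 1 xpredT (@mul_continuous C) _ _ _ _ _ (nbhs_filter A)) => i _.
exact: matrix_entry_cvg.
Qed.

Lemma SU_compact : compact [set: SU R n].
Proof.
have cS : compact (@special_unitary R n).
  exact: (subclosed_compact special_unitary_closed box_compact special_unitary_box).
(* The default value 1 is taken off the special unitary matrices; continuity is claimed only within
   them. *)
pose h (A : 'M[C]_n) : SU R n := insubd (1%g : SU R n) A.
have hK A : @special_unitary R n A -> val (h A) = A.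
  by move=> SA; rewrite /h insubdK// mem_set.
have -> : [set: SU R n] = h @` @special_unitary R n.
  apply/seteqP; split=> // s _; exists (val s); first exact: set_mem (valP s).
  by apply: val_inj; rewrite hK//; exact: set_mem (valP s).
apply: continuous_compact cS.
apply/subspace_continuousP => A SA B [_ [[U oU <-] UA UB]].
have nU : nbhs A U by apply: open_nbhs_nbhs; split => //; rewrite -(hK A SA).
apply: filterS (nU) => A' UA' SA'; apply: UB.
by have : U (val (h A')) by rewrite hK.
Qed.
End SpecialUnitaryCompact.

(** * Generic subgroups *)

Section GenericSubgroups.
Variables (R : realType) (d : forall k, biinvariant_metric R (SU R k.+1)).
Let D : bounded_metric R (SUprod R) := prod_metric (fun k => bimetric (d k)).
Local Notation S := (subgroup_space D).

(** The first [m] terms vanish and the others are dominated by the geometric tail, whose weights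
    2^-(k+1) for k >= m add up to 2^-m. *)
Lemma tail_dist_le m (x : SUprod R) : tail_subgroup m x -> D 1%g x <= 2 ^- m.
Proof.
move=> xm; pose t k : R := 2 ^- k.+1 * d k 1%g (x k).
have -> : D 1%g x = limn (series t) by [].
apply: limr_le; first exact: (@is_cvg_prod_dist R
  (fun k => SU R k.+1 : topologicalType) (fun k => bimetric (d k)) (1%g : SUprod R) x).
have tle k : 0 <= t k <= 2 ^- k.+1.
  apply/andP; split; first by rewrite mulr_ge0 ?bdist_ge0// ltW// expn2N_gt0.
  by rewrite ler_piMr ?bdist_le1// ltW// expn2N_gt0.
have half k : 2 ^- k.+1 = 2 ^- k / 2 :> R by rewrite exprS invfM mulrC.
suff h j : series t j <= if (j <= m)%N then 0 else 2 ^- m - 2 ^- j.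
  exists 0%N => // j _ /=; apply: le_trans (h j) _; have := expn2N_gt0 R m.
  by have := expn2N_gt0 R j; case: ifP => _; lra.
elim: j => [|j IH]; first by rewrite /series/= big_geq.
rewrite /series/= big_nat_recr//=; move: IH; rewrite /series/= => IH.
have := tle j; rewrite half => /andP[t0 t1].
have [jm|mj] := leqP j.+1 m.
  by rewrite (ltnW jm) in IH; rewrite {2}/t xm// bdistxx mulr0 addr0.
have [jm|mj'] := leqP j m; last by rewrite leqNgt mj' /= in IH; lra.
rewrite jm in IH; have -> : m = j by apply/eqP; rewrite eqn_leq jm -ltnS mj.
lra.
Qed.

Definition emb n (s : SU R n.+1) : SUprod R :=
  @dfwith nat (fun k => SU R k.+1) (1%g : SUprod R) n s.

Lemma emb_in n (s : SU R n.+1) : emb s n = s.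
Proof. exact: (@dfwith_in nat (fun k => SU R k.+1 : Type) (1%g : SUprod R) n s). Qed.

Lemma emb_out n (s : SU R n.+1) k : n != k -> emb s k = 1%g.
Proof. exact: (@dfwith_out nat (fun k => SU R k.+1 : Type) (1%g : SUprod R) n s k). Qed.

Lemma emb_tail n (s : SU R n.+1) : tail_subgroup n (emb s).
Proof. by move=> k kn; apply: emb_out; rewrite gtn_eqF. Qed.

Definition contains_factor n (H : set (SUprod R)) := forall s : SU R n.+1, H (emb s).

Section Enlarge.
Variables (G : compact_subgroup (SUprod R)) (n : nat).

(** The product of [G] with the normal factor of index [n], described by leaving the n-th coordinate
    free: the subgroup laws are then coordinatewise, and compactness comes from the product form
    [enlargeE]. *)
Definition enlarge : set (SUprod R) :=
  [set x | exists2 h, (G : set _) h & forall k, n != k -> x k = h k].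

Lemma enlargeE : enlarge = (fun p => p.1 * emb p.2)%g @` ((G : set _) `*` [set: SU R n.+1]).
Proof.
apply/seteqP; split=> [x [h Gh xh]|_ [[h s] [Gh _] <-]]; last first.
  by exists h => // k nk; rewrite -[LHS]/(h k * emb s k)%g emb_out// mulg1.
exists (h, (h n)^-1 * x n)%g => //; apply: functional_extensionality_dep => k /=.
rewrite -[LHS]/(h k * emb _ k)%g.
have [<-|nk] := eqVneq n k; first by rewrite emb_in mulVKg.
by rewrite emb_out// mulg1 xh.
Qed.

Lemma enlarge_compact : compact enlarge.
Proof.
rewrite enlargeE; apply: continuous_compact; last first.
  by apply: compact_setX; [exact: csubgroup_compact|exact: SU_compact].
apply: continuous_subspaceT => -[h s].
apply: (mulg_cvg (nbhs_filter (h, s))); first exact: cvg_fst.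
apply: (@cvg_comp _ _ _ snd (@emb n)); first exact: cvg_snd.
apply: (prod_cvgP (nbhs_filter s)) => k.
have [<-|nk] := eqVneq n k.
  by under eq_fun do rewrite emb_in; rewrite emb_in; exact: cvg_id.
by under eq_fun do rewrite emb_out//; rewrite emb_out//; exact: cvg_cst.
Qed.

Lemma enlarge_subgroup : is_subgroup enlarge.
Proof.
have [/set_mem G1 GV] := csubgroupP G.
split; first by apply/mem_set; exists 1%g.
move=> x y /set_mem[h Gh xh] /set_mem[h' Gh' yh']; apply/mem_set; exists (h / h')%g.
  by apply/set_mem/GV; exact: mem_set.
move=> k nk; rewrite -[LHS]/(x k / y k)%g xh// yh'//.
Qed.

Definition enlarged : S := CompactSubgroup enlarge_subgroup enlarge_compact.

Lemma enlarged_factor : contains_factor n enlarged.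
Proof. by move=> s; exists 1%g; [exact: csubgroup1|move=> k nk; rewrite emb_out]. Qed.

Lemma enlarged_dist : @mdist R S (G : S) enlarged <= 2 ^- n.
Proof.
rewrite /mdist /= ge_max; apply/andP; split.
  apply/(@excessP R _ D G enlarged) => x Gx e e0; exists x; first by exists x.
  by rewrite bdistxx ltr_wpDr// ltW// expn2N_gt0.
apply/(@excessP R _ D enlarged G) => x; rewrite /= enlargeE => -[[h s] [Gh _] <-] e e0.
have hs : D (h * emb s)%g h <= 2 ^- n.
  rewrite bdistC; have := tail_dist_le (@emb_tail n s).
  have -> : D 1%g (emb s) = D (h * 1)%g (h * emb s)%g by apply/esym; exact: (prod_metricMl d).
  by rewrite mulg1.
by exists h => //; apply: le_lt_trans hs _; rewrite ltrDl.
Qed.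
End Enlarge.

(** Some [x] in [G] is close to [emb s], and right invariance makes [x / emb s] close to 1, which
    controls finitely many coordinates. The margin [delta / C] pays for the final multiplication by
    [val s], of norm at most [C]. *)
Lemma near_factor N (delta : R) : 0 < delta -> exists2 e, 0 < e &
  forall (H G : S), contains_factor N.+2 H -> @mdist R S H G < e ->
  forall s : SU R N.+3, exists2 x, (G : set _) x &
    l1norm (val (x N.+2) - val s) <= delta /\ forall k, (k < N.+2)%N -> dist1 (x k) <= delta.
Proof.
move=> delta0; pose C : R := (N.+3 ^ 2)%:R.
have C1 : 1 <= C by rewrite ler1n expn_gt0.
have C0 : 0 < C by exact: lt_le_trans C1.
have e0 : 0 < delta / C by rewrite divr_gt0.
have nU : nbhs (1%g : SUprod R) [set x : SUprod R | forall k : 'I_N.+3, dist1 (x k) < delta / C].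
  apply: (@filter_forall _ _ (fun (k : 'I_N.+3) (x : SUprod R) => dist1 (x k) < delta / C)
    (nbhs (1%g : SUprod R))) => k.
  have /cvgrPdist_lt/(_ _ e0) := @dist1_coord_continuous R k 1%g.
  apply: filterS => x; rewrite dist1_1 sub0r normrN; apply: le_lt_trans.
  exact: ler_norm.
have [e ege0 eU] := (bdist_nbhs D _ _).1 nU.
exists e => // H G Hn HG s.
have [r rE] : exists r, r = @mdist R S H G by eexists.
rewrite -rE in HG.
have : excess D H G <= r by rewrite rE /mdist /= le_max lexx.
(* The infimum in the excess is approached within [e - r], the room left below [e]. *)
move=> /(@excessP R _ D H G)/(_ _ (Hn s) (e - r)).
rewrite subr_gt0 => /(_ HG)[x Gx]; rewrite addrC subrK => xs.
exists x => //.
have {}eU : forall k : 'I_N.+3, dist1 ((x / emb s)%g k) < delta / C.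
  apply: eU => /=.
  have DE : D 1%g (x / emb s)%g = D (emb s) x.
    by rewrite -(mulgV (emb s)); exact: (prod_metricMr d).
  exact: (eq_ind_r (fun t => t < e) xs DE).
split.
  have := eU ord_max; rewrite -[(x / emb s)%g _]/(x N.+2 / emb s N.+2)%g emb_in => h.
  have -> : val (x N.+2) - val s = (val (x N.+2 / s)%g - 1%:M) *m val s.
    by rewrite mulmxBl mul1mx -val_mulSU divgK.
  apply: le_trans (l1normM _ _) _; apply: (@le_trans _ _ (delta / C * C)).
    by apply: ler_pM; [exact: l1norm_ge0|exact: l1norm_ge0|exact: ltW|exact: l1norm_SU].
  by rewrite divfK// gt_eqF.
move=> k kN; have := eU (Ordinal (leqW kN)).
rewrite -[(x / emb s)%g _]/(x k / emb s k)%g emb_out ?gtn_eqF// invg1 mulg1.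
by move=> /ltW/le_trans; apply; rewrite ler_pdivrMr// ler_peMr// ltW.
Qed.

Lemma near_factor_small_subgroup N : exists2 e, 0 < e &
  forall (H G : S), contains_factor N.+2 H -> @mdist R S H G < e ->
  exists K : set (SUprod R),
  [/\ is_subgroup K, K `<=` identity_component (G : set (SUprod R)),
      K `<=` tail_subgroup N.+2 & exists2 y, K y & y <> 1%g].
Proof.
pose a := angle R N ^+ 2; pose b := shrink R N ^+ 3 / (4 * unitary_bound R N).
have C0 : 0 < 4 * unitary_bound R N by rewrite mulr_gt0// unitary_bound_gt0.
have delta0 : 0 < Num.min a b.
  by rewrite lt_min exprn_gt0 ?angle_gt0//= divr_gt0// exprn_gt0// shrink_gt0.
have [e e0 he] := near_factor N delta0.
exists e => // H G Hn HG.
apply: (small_connected_subgroup d (ltW delta0) _ _ (he H G Hn HG)).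
  by rewrite ge_min lexx.
by rewrite mulrC -ler_pdivlMr// ge_min lexx orbT.
Qed.

Definition radius N : R := sval (cid2 (near_factor_small_subgroup N)).

Lemma radius_gt0 N : 0 < radius N.
Proof. by rewrite /radius; case: cid2. Qed.

Lemma radiusP N (H G : S) : contains_factor N.+2 H -> @mdist R S H G < radius N ->
  exists K : set (SUprod R),
  [/\ is_subgroup K, K `<=` identity_component (G : set (SUprod R)),
      K `<=` tail_subgroup N.+2 & exists2 y, K y & y <> 1%g].
Proof. by rewrite /radius; case: cid2 => e /= _; apply. Qed.

(** The index [n.+2] denotes the factor SU(n + 3): the lower bound for commutators requires at least
    three coordinates. *)
Definition near_factors m : set S :=
  [set G : S | exists n (H : S),
    [/\ (m <= n)%N, contains_factor n.+2 H & @mdist R S H G < radius n]].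

Lemma near_factors_open m : open (near_factors m).
Proof.
rewrite openE => G [n [H [mn Hn HG]]].
apply/nbhs_ballP; exists (radius n - mdist H G); first by rewrite /= subr_gt0.
move=> G'; rewrite ballEmdist /= => GG'; exists n, H; split => //.
apply: le_lt_trans (metric_triangle H G G') _.
by rewrite -ltrBrDl.
Qed.

Lemma near_factors_dense m : dense (near_factors m).
Proof.
move=> U [G UG]; rewrite openE => /(_ G UG)/nbhs_ballP[e /= e0 eU].
have [j hj] := expn2N_lt e0.
pose n := maxn m j.
exists (enlarged G n.+2); split.
  apply: eU; rewrite ballEmdist /=; apply: le_lt_trans (enlarged_dist G n.+2) _.
  by apply: hj; exact: leqW (leqW (leq_maxr _ _)).
exists n, (enlarged G n.+2); split; [exact: leq_maxl|exact: enlarged_factor|].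
by rewrite mdistxx radius_gt0.
Qed.

(** A neighbourhood of 1 in the identity component contains the trace of a ball of radius [e]. For
    [2 ^- m < e] the nontrivial subgroup [K] lies in that ball, so all powers of [y] stay in the
    neighbourhood. *)
Lemma near_factors_not_lie (G : S) : (forall m, near_factors m G) ->
  ~ is_lie_group R (identity_component_group G).
Proof.
move=> Gm /lie_group_no_small_subgroup[W [_ [[U oU <-] U1 UW]] Wx].
have [e e0 eU] : exists2 e, 0 < e & [set x | D 1%g x < e] `<=` U.
  by apply/(bdist_nbhs D); apply: open_nbhs_nbhs.
have [m me] := expn2N_lt e0.
have [n [H [mn Hn HG]]] := Gm m.
have [K [sK KG Km [y Ky y1]]] := radiusP Hn HG.
pose x : identity_component_group G := Sub y (mem_set (KG y Ky)).
have valX j : val (x ^+ j)%g = (y ^+ j)%g.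
  by elim: j => [|j IH]; rewrite ?expg0// !expgS -IH.
apply: y1; have -> : y = val x by [].
rewrite (Wx x)// => j; apply: UW.
suff : U (val (x ^+ (2 ^ j))%g) by [].
rewrite valX; apply: eU => /=.
apply: le_lt_trans (tail_dist_le (Km _ (subgroup_expg sK _ Ky))) _.
by apply: me; exact: leqW (leqW mn).
Qed.
End GenericSubgroups.

Theorem theorem5p22 (R : realType)
    (d : forall k : nat, biinvariant_metric R (SU R k.+1)) :
  comeager
    [set G : subgroup_space
               (prod_metric (fun k => bimetric (d k)) : bounded_metric R (SUprod R))
     | ~ is_lie_group R (identity_component_group G)].
Proof.
exists (@near_factors R d); split.
  by move=> m; split; [exact: near_factors_open|exact: near_factors_dense].
by move=> G Gm; apply: near_factors_not_lie => m; exact: Gm.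
Qed.
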